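(* Let $\Lambda\subset\mathbb{C}$ be a lattice generated by $1$ and $w$, with $w$ quadratic over $\mathbb{Q}$, so that the elliptic curve $E(\Lambda)=\mathbb{C}/\Lambda$ admits complex multiplication, and let $R=\operatorname{End}(E(\Lambda))$. Let $\mathcal{E}$ be a central elliptic arrangement in $E(\Lambda)^d$, and let $\mathcal{M}$ be the $R$-matroid realized by $\mathcal{E}$. Then the elliptic Tutte polynomial of $\mathcal{E}$ is the evaluation $\tilde T_{\mathcal{M}}$ of the Grothendieck-Tutte polynomial of $\mathcal{M}$: \[ T^e_{\mathcal{E}}(x,y)=\tilde T_{\mathcal{M}}(x,y). \]
   Context: A lattice $\Lambda\subset\mathbb{C}$ is a free rank-two additive subgroup spanning $\mathbb{C}$ over $\mathbb{R}$. $\operatorname{End}(E(\Lambda))$ is the ring of isogenies (regular group endomorphisms, including $0$) of $E(\Lambda)$; it may be identified with $\{a\in\mathbb{C}:a\Lambda\subseteq\Lambda\}$. In the complex multiplication case it is an order in an imaginary quadratic field. A central elliptic arrangement $\mathcal{E}$ in $E(\Lambda)^d$ is given by a finite list of nonzero homomorphisms $l_1,\dots,l_n:E(\Lambda)^d\to E(\Lambda)$; its elliptic hyperplanes are the kernels $\ker l_i$. Each $l_i$ has the form $l_i(z_1,\dots,z_d)=\sum_j v_{j,i}z_j$ for a vector $v_i=(v_{1,i},\dots,v_{d,i})\in R^d$. The $R$-matroid realized by $\mathcal{E}$ is $\mathcal{M}(A)=R^d/(v_i:i\in A)$ for $A\subseteq[n]=\{1,\dots,n\}$. The elliptic Tutte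 polynomial of $\mathcal{E}$ is \[T^e_{\mathcal{E}}(x,y)=\sum_{S\subseteq[n]}m(S)(x-1)^{r'-\operatorname{rk}(S)}(y-1)^{|S|-\operatorname{rk}(S)},\] where $m(S)$ is the number of connected components of $\bigcap_{i\in S}\ker l_i$ (equal to $E(\Lambda)^d$ for $S=\emptyset$), $\operatorname{rk}(S)$ is the complex codimension of $\bigcap_{i\in S}\ker l_i$ in $E(\Lambda)^d$, and $r'=\operatorname{rk}([n])$ is the rank of $\mathcal{E}$. With $Q(R)$ the field of fractions of $R$, $\operatorname{tor}(A)$ the torsion submodule of $\mathcal{M}(A)$, $\operatorname{tor}(A)^\vee=\operatorname{Hom}_R(\operatorname{tor}(A),Q(R)/R)$ (a finite module here), $\operatorname{rk}_{\mathcal{M}}(A)=\dim_{Q(R)}(\mathcal{M}(\emptyset)\otimes Q(R))-\dim_{Q(R)}(\mathcal{M}(A)\otimes Q(R))$ and $r=\operatorname{rk}_{\mathcal{M}}([n])$, \[\tilde T_{\mathcal{M}}(x,y)=\sum_{A\subseteq[n]}|\operatorname{tor}(A)^\vee|(x-1)^{r-\operatorname{rk}_{\mathcal{M}}(A)}(y-1)^{|A|-\operatorname{rk}_{\mathcal{M}}(A)}\in\mathbb{Z}[x,y].\] It is the evaluation of the Grothendieck-Tutte polynomial $\sum_A[\operatorname{tor}(A)^\vee](x-1)^{r-\operatorname{rk}_{\mathcal{M}}(A)}(y-1)^{|A|-\operatorname{rk}_{\mathcal{M}}(A)}$ obtained by replacing each class $[\operatorname{tor}(A)^\vee]$ by the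 cardinality of the module. *)

(* Defs.v *)
From HB Require Import structures.
From mathcomp Require Import all_boot all_order all_algebra.
From mathcomp Require Import generic_quotient ring_quotient fraction.
From mathcomp Require Import complex finmap.
From mathcomp Require Import all_classical all_reals.
From mathcomp Require Import topology normedtype.
From mathcomp.multinomials Require Import freeg.

Set Implicit Arguments.
Unset Strict Implicit.
Unset Printing Implicit Defensive.

Import Order.TTheory GRing.Theory Num.Theory.
Import numFieldNormedType.Exports.

Local Open Scope ring_scope.
Local Open Scope classical_set_scope.
Local Open Scope quotient_scope.

Section Span.
Variables (R : nzRingType) (V : lmodType R).

Definition in_span (S : set V) : {pred V} := fun x =>
  `[< exists n (c : 'I_n -> R) (s : 'I_n -> V),
        (forall i, S (s i)) /\ x = \sum_i c i *: s i >].

Variable S : set V.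

Lemma in_span_submod_closed : submod_closed (in_span S).
Proof.
split.
  by apply/asboolP; exists 0%N, (fun=> 0), (fun=> 0); split=> [[]|] //;
    rewrite big_ord0.
move=> a x y /asboolP[n [c [s [Ss ->]]]] /asboolP[m [e [t [St ->]]]].
apply/asboolP; exists (n + m)%N.
exists (fun i => match fintype.split i with inl j => a * c j | inr j => e j end).
exists (fun i => match fintype.split i with inl j => s j | inr j => t j end); split.
  by move=> i; case: (fintype.split i).
rewrite big_split_ord /= scaler_sumr; congr (_ + _); apply: eq_bigr => i _.
  by case: split_ordP => j; [move/lshift_inj <-; rewrite scalerA
                            | move/eqP; rewrite eq_lrshift].
by case: split_ordP => j; [move/eqP; rewrite eq_rlshift
                          | move/rshift_inj <-].
Qed.
HB.instance Definition _ :=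
  GRing.isSubmodClosed.Build R V (in_span S) in_span_submod_closed.

End Span.

Section QuotientModule.
Variables (R : nzRingType) (V : lmodType R) (N : submodClosed V).

Definition submod_pred : {pred V} := N.

Lemma submod_pred_zmod_closed : zmod_closed submod_pred.
Proof.
by split=> [|x y xN yN]; rewrite /submod_pred ?rpred0 // -scaleN1r rpredD // rpredZ.
Qed.
HB.instance Definition _ :=
  GRing.isZmodClosed.Build V submod_pred submod_pred_zmod_closed.

Definition quotmod : Type := Quotient.quot submod_pred.
HB.instance Definition _ := GRing.Zmodule.on quotmod.
HB.instance Definition _ := Quotient.on quotmod.

Definition quotmod_scale (a : R) (x : quotmod) : quotmod :=
  \pi_quotmod (a *: repr x).

Lemma pi_quotmodP (x y : V) :
  reflect (\pi_quotmod x = \pi_quotmod y) (x - y \in N).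
Proof.
by rewrite -[x - y \in N]/(x - y \in submod_pred) Quotient.idealrBE; exact: eqP.
Qed.

Lemma pi_quotmodD (x y : V) :
  \pi_quotmod (x + y) = \pi_quotmod x + \pi_quotmod y.
Proof. exact: (raddfD (\pi_(Quotient.quot submod_pred))). Qed.

Lemma pi_quotmodZ (a : R) (x : V) :
  \pi_quotmod (a *: x) = quotmod_scale a (\pi_quotmod x).
Proof.
apply/pi_quotmodP; rewrite -scalerBr rpredZ //.
by apply/pi_quotmodP; rewrite reprK.
Qed.

Lemma quotmod_scalerA a b x :
  quotmod_scale a (quotmod_scale b x) = quotmod_scale (a * b) x.
Proof.
rewrite -[x]reprK; move: (repr x) => {}x.
by rewrite -(pi_quotmodZ b x) -!pi_quotmodZ scalerA.
Qed.

Lemma quotmod_scale1r : left_id 1 quotmod_scale.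
Proof.
by move=> x; rewrite -[x]reprK; move: (repr x) => {}x; rewrite -pi_quotmodZ scale1r.
Qed.

Lemma quotmod_scalerDr : right_distributive quotmod_scale +%R.
Proof.
move=> a x y; rewrite -[x]reprK -[y]reprK; move: (repr x) (repr y) => {}x {}y.
by rewrite -pi_quotmodD -!pi_quotmodZ -pi_quotmodD scalerDr.
Qed.

Lemma quotmod_scalerDl x : {morph quotmod_scale^~ x : a b / a + b}.
Proof.
move=> a b; rewrite -[x]reprK; move: (repr x) => {}x.
by rewrite -!pi_quotmodZ -pi_quotmodD scalerDl.
Qed.

HB.instance Definition _ := GRing.Zmodule_isLmodule.Build R quotmod
  quotmod_scalerA quotmod_scale1r quotmod_scalerDr quotmod_scalerDl.

End QuotientModule.

(* The size of a basis of S; 0 by default if S is not a subspace of V of finite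
   dimension. *)
Definition dim_of (K : fieldType) (V : lmodType K) (S : set V) : nat :=
  get [set n | exists b : 'I_n -> V,
    (forall x, S x <-> exists c : 'I_n -> K, x = \sum_i c i *: b i) /\
    (forall c : 'I_n -> K, \sum_i c i *: b i = 0 -> forall i, c i = 0)].

Section Torsion.
Variables (R : idomainType) (M : lmodType R).

Definition is_torsion : {pred M} := fun x =>
  `[< exists2 a : R, a != 0 & a *: x = 0 >].

Lemma is_torsion_submod_closed : submod_closed is_torsion.
Proof.
split; first by apply/asboolP; exists 1; rewrite ?oner_neq0 ?scaler0.
move=> a x y /asboolP[b b0 bx] /asboolP[c c0 cy]; apply/asboolP.
exists (b * c); first by rewrite mulf_neq0.
rewrite scalerDr -[X in _ + X]scalerA cy scaler0 addr0.
by rewrite scalerA -mulrA mulrC -scalerA bx scaler0.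
Qed.
HB.instance Definition _ :=
  GRing.isSubmodClosed.Build R M is_torsion is_torsion_submod_closed.

Definition torsion : Type := {x : M | x \in is_torsion}.
HB.instance Definition _ := SubChoice.on torsion.
HB.instance Definition _ := [SubChoice_isSubLmodule of torsion by <:].

End Torsion.

Section FractionModule.
Variable R : idomainType.

(* {fraction R} carries no R-module structure in the library. *)
Definition fracmod : Type := {fraction R}.
HB.instance Definition _ := GRing.Zmodule.on fracmod.

Definition fracmod_scale (a : R) (x : fracmod) : fracmod :=
  FracField.tofrac a * (x : {fraction R}).

Lemma fracmod_scalerA a b x :
  fracmod_scale a (fracmod_scale b x) = fracmod_scale (a * b) x.
Proof. by rewrite /fracmod_scale mulrA rmorphM. Qed.
Lemma fracmod_scale1r : left_id 1 fracmod_scale.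
Proof. by move=> x; rewrite /fracmod_scale rmorph1 mul1r. Qed.
Lemma fracmod_scalerDr : right_distributive fracmod_scale +%R.
Proof. by move=> a x y; exact: mulrDr. Qed.
Lemma fracmod_scalerDl x : {morph fracmod_scale^~ x : a b / a + b}.
Proof. by move=> a b; rewrite /fracmod_scale rmorphD; exact: mulrDl. Qed.
HB.instance Definition _ := GRing.Zmodule_isLmodule.Build R fracmod
  fracmod_scalerA fracmod_scale1r fracmod_scalerDr fracmod_scalerDl.

Definition frac_int : submodClosed fracmod :=
  in_span [set (FracField.tofrac (1 : R) : fracmod)].

(* Q(R)/R: R is the submodule of Q(R) generated by 1. *)
Definition frac_quot := quotmod frac_int.

End FractionModule.

(* Returns 0 on infinite sets. *)
Definition card_set (T : choiceType) (A : set T) : nat := #|` fset_set A|%fset.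

(* |Hom_R(M, Q(R)/R)| *)
Definition card_dual (R : idomainType) (M : lmodType R) : nat :=
  card_set [set f : M -> frac_quot R | linear f].

Section ExtensionOfScalars.
Variables (R : idomainType) (M : lmodType R).
Local Notation K := {fraction R}.
Local Notation F := {freeg M / K}.
Local Notation e x := (<< x >> : F).

Definition tensor_rel : set F :=
  [set u | exists x y : M, u = e (x + y) - e x - e y] `|`
  [set u | exists (a : R) (x : M), u = e (a *: x) - FracField.tofrac a *: e x].

(* The tensor product of M and Q(R) over R: the free Q(R)-module on M modulo
   the relations making M -> tensor_frac additive and R-linear. *)
Definition tensor_frac : lmodType K := quotmod (in_span tensor_rel).

Definition generic_rank : nat := dim_of [set: tensor_frac].

End ExtensionOfScalars.

(* The variables are x = 'X and y = 'Y = 'X%:P. Both exponents are truncated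
   subtractions, which are exact for the rank functions used here. *)
Definition tutte_sum (n : nat) (m rk : {set 'I_n} -> nat) : {poly {poly int}} :=
  \sum_(A : {set 'I_n}) (m A)%:R * ('X - 1) ^+ (rk [set: 'I_n]%SET - rk A)%N
                                 * ('Y - 1) ^+ (#|A| - rk A)%N.

Definition realized_module (R : idomainType) (d n : nat) (v : 'I_n -> 'rV[R]_d)
    (A : {set 'I_n}) : lmodType R :=
  quotmod (in_span (v @` [set` A])).

Section Matroid.
Variables (R : idomainType) (n : nat) (M : {set 'I_n} -> lmodType R).

(* generic_rank (M A) is the dimension over Q(R) of the tensor product of M(A)
   with Q(R). *)
Definition rk_mod (A : {set 'I_n}) : nat :=
  (generic_rank (M finset.set0) - generic_rank (M A))%N.

Definition grothendieck_tutte_card : {poly {poly int}} :=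
  tutte_sum (fun A => card_dual (torsion (M A))) rk_mod.

End Matroid.

(* A free subgroup of rank two, with Z-basis (u, v), spanning C over R. *)
Definition is_lattice (R : realType) (L : zmodClosed R[i]) : Prop :=
  exists u v : R[i],
  [/\ forall z, z \in L <-> exists m n : int, z = m%:~R * u + n%:~R * v,
      forall m n : int, m%:~R * u + n%:~R * v = 0 -> m = 0 /\ n = 0 &
      forall z : R[i], exists s t : R, z = s%:C%C * u + t%:C%C * v].

Definition quadratic_over_Q (R : realType) (w : R[i]) : Prop :=
  exists p : {poly rat},
    [/\ irreducible_poly p, size p = 3%N & root (map_poly ratr p) w].

Section EndomorphismRing.
Variables (R : realType) (L : zmodClosed R[i]).

Definition preserves_lattice : {pred R[i]} := fun a =>
  `[< forall z, z \in L -> a * z \in L >].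

Lemma preserves_lattice_subring_closed : subring_closed preserves_lattice.
Proof.
split; first by apply/asboolP => z; rewrite mul1r.
  move=> a b /asboolP aL /asboolP bL; apply/asboolP => z zL.
  by rewrite mulrBl rpredB ?aL ?bL.
move=> a b /asboolP aL /asboolP bL; apply/asboolP => z zL.
by rewrite -mulrA aL ?bL.
Qed.
HB.instance Definition _ := GRing.isSubringClosed.Build R[i] preserves_lattice
  preserves_lattice_subring_closed.

(* End(E(L)), identified with {a in C | a L is contained in L}. *)
Definition endE : Type := {a : R[i] | a \in preserves_lattice}.
HB.instance Definition _ := SubChoice.on endE.
HB.instance Definition _ := [SubChoice_isSubComNzRing of endE by <:].

Definition endE_unit : pred endE := fun a => `[< exists b, b * a = 1 >].
Definition endE_inv (a : endE) : endE := xget a [set b | b * a = 1].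

Lemma endE_mulVr : {in endE_unit, left_inverse 1 endE_inv *%R}.
Proof. by move=> a /asboolP ex; exact: (xgetPex a ex). Qed.
Lemma endE_unitP (x y : endE) : y * x = 1 -> endE_unit x.
Proof. by move=> yx; apply/asboolP; exists y. Qed.
Lemma endE_inv_out : {in [predC endE_unit], endE_inv =1 id}.
Proof.
move=> a /negP nua; rewrite /endE_inv xgetPN // => b ba.
by apply: nua; apply/asboolP; exists b.
Qed.
HB.instance Definition _ := GRing.ComNzRing_hasMulInverse.Build endE
  endE_mulVr endE_unitP endE_inv_out.

Lemma endE_integral : GRing.integral_domain_axiom endE.
Proof.
move=> a b /(congr1 val) /= /eqP; rewrite mulf_eq0 => /orP[] /eqP z0;
  by apply/orP; [left + right]; apply/eqP/val_inj.
Qed.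
HB.instance Definition _ :=
  GRing.ComUnitRing_isIntegral.Build endE endE_integral.

End EndomorphismRing.

Section EllipticCurve.
Variables (R : realType) (L : zmodClosed R[i]).

Local Notation quot_group := (Quotient.quot L).

(* C / L, with the quotient of the usual topology of C (carried by R[i]^o). *)
Definition ellcurve : Type := quotient_topology (quot_group : quotType R[i]^o).
HB.instance Definition _ := Topological.on ellcurve.
HB.instance Definition _ := Quotient.on ellcurve.
HB.instance Definition _ := GRing.isZmodule.Build ellcurve
  (@addrA quot_group) (@addrC quot_group) (@add0r quot_group) (@addNr quot_group).

Definition ellcurve_scale (a : endE L) (x : ellcurve) : ellcurve :=
  \pi_ellcurve (val a * repr x).

Lemma pi_ellcurveP (x y : R[i]) :
  reflect (\pi_ellcurve x = \pi_ellcurve y) (x - y \in L).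
Proof. by rewrite Quotient.idealrBE; exact: (@eqP quot_group). Qed.

Lemma pi_ellcurveD (x y : R[i]) :
  \pi_ellcurve (x + y) = \pi_ellcurve x + \pi_ellcurve y.
Proof. exact: (raddfD (\pi_quot_group)). Qed.

Lemma pi_ellcurveM (a : endE L) (x : R[i]) :
  \pi_ellcurve (val a * x) = ellcurve_scale a (\pi_ellcurve x).
Proof.
apply/pi_ellcurveP; rewrite -mulrBr; have /asboolP := valP a; apply.
by apply/pi_ellcurveP; rewrite reprK.
Qed.

Lemma ellcurve_scalerA a b x :
  ellcurve_scale a (ellcurve_scale b x) = ellcurve_scale (a * b) x.
Proof.
rewrite -[x]reprK; move: (repr x) => {}x.
by rewrite -(pi_ellcurveM b x) -!pi_ellcurveM mulrA.
Qed.

Lemma ellcurve_scale1r : left_id 1 ellcurve_scale.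
Proof.
by move=> x; rewrite -[x]reprK; move: (repr x) => {}x; rewrite -pi_ellcurveM mul1r.
Qed.

Lemma ellcurve_scalerDr : right_distributive ellcurve_scale +%R.
Proof.
move=> a x y; rewrite -[x]reprK -[y]reprK; move: (repr x) (repr y) => {}x {}y.
by rewrite -pi_ellcurveD -!pi_ellcurveM -pi_ellcurveD mulrDr.
Qed.

Lemma ellcurve_scalerDl x : {morph ellcurve_scale^~ x : a b / a + b}.
Proof.
move=> a b; rewrite -[x]reprK; move: (repr x) => {}x.
by rewrite -!pi_ellcurveM -pi_ellcurveD mulrDl.
Qed.

HB.instance Definition _ := GRing.Zmodule_isLmodule.Build (endE L) ellcurve
  ellcurve_scalerA ellcurve_scale1r ellcurve_scalerDr ellcurve_scalerDl.

Variable d : nat.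

(* E(L)^d is 'rV[ellcurve]_d, with the product topology.
   The Lie algebra of a closed subgroup K of E(L)^d = C^d / L^d: the set of
   directions of the one-parameter subgroups contained in K. *)
Definition lie_algebra (K : set 'rV[ellcurve]_d) : set 'rV[R[i]]_d :=
  [set x | forall t : R, K (map_mx \pi_ellcurve (t%:C%C *: x))].

Definition complex_codim (K : set 'rV[ellcurve]_d) : nat :=
  (d - dim_of (lie_algebra K))%N.

Variables (n : nat) (l : 'I_n -> 'rV[ellcurve]_d -> ellcurve).

Definition ker_inter (S : {set 'I_n}) : set 'rV[ellcurve]_d :=
  [set z | forall i, i \in S -> l i z = 0].

Definition nb_components (S : {set 'I_n}) : nat :=
  card_set [set connected_component (ker_inter S) z | z in ker_inter S].

Definition elliptic_tutte : {poly {poly int}} :=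
  tutte_sum nb_components (fun S => complex_codim (ker_inter S)).

End EllipticCurve.

(* Main.v *)
From HB Require Import structures.
Require Import Defs.
From mathcomp Require Import all_boot all_order all_algebra.
From mathcomp Require Import generic_quotient fraction.
From mathcomp Require Import complex.
From mathcomp Require Import all_classical all_reals.
From mathcomp Require Import topology normedtype.
From mathcomp.multinomials Require Import freeg.
From mathcomp Require Import ring.

Set Implicit Arguments.
Unset Strict Implicit.
Unset Printing Implicit Defensive.

Import Order.TTheory GRing.Theory Num.Theory.
Import numFieldNormedType.Exports.

Local Open Scope ring_scope.
Local Open Scope quotient_scope.

(** Write O for the ring of endomorphisms of E = C / L, and fix a subset A of
    the arrangement. Both Tutte polynomials are sums over A of the same shape,
    so it suffices to compare, for each A, the two ranks and the two
    multiplicities.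

    Ranks. A one-parameter subgroup t |-> t x lies in K, the intersection of
    the kernels, exactly when x is orthogonal to the v_i, i in A, because L is
    discrete. Hence the complex codimension of K is the rank of the matrix of
    the v_i over C. The dimension of M(A) tensored with the fraction field is
    d minus the rank of the same matrix over that field, and rank is
    insensitive to the field extension Frac(O) -> C.

    Multiplicities. Let M = O^d / span(v_i, i in A), and let T be the
    saturation of the span in O^d, so that T / span is the torsion of M. A point
    z of K is an O-linear map r |-> r.z from M to E, and restricting it to the
    torsion of M gives an O-linear map tor(M) -> E. Two facts show that the
    fibres of this restriction are the connected components of K and that it
    is onto:
    - a linear map T -> L extends to O^d (saturated_lift): so two points with
      the same restriction are joined by the image in K of a line
      (component_of_agree);
    - a linear map T -> E extends to O^d (saturated_extend).
    Conversely restriction is locally constant on K, since it takes values in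
    the m-torsion of E for a fixed m, and T is finitely generated (agree_near).

    Both extension statements follow from three ingredients. As a group, T is
    a direct summand of O^d, by the Smith normal form. The ring O = Z[tau] is
    Gorenstein: the coefficient of tau is a linear form which makes an O-linear
    map into O (or into C / O) the same thing as a Z-linear map into Z (or into
    the reals modulo Z), and these extend from a direct summand
    (coinduced_vecP). Finally L is an invertible O-module (lattice_invertible),
    which reduces maps into L to maps into O: here it is used that w is a root
    of a primitive integral quadratic polynomial a X^2 + b X + c, with
    O = Z + Z a w.

    It remains to identify Hom(tor(M), E) with Hom(tor(M), Frac(O) / O). If m
    kills tor(M), only the m-torsion of either target matters. The norm form of
    L is a primitive quadratic form, so it takes a value q prime to m
    (coprime_value); this yields lambda in L and mu with mu L inside O and
    mu lambda = q, and multiplication by mu is an isomorphism between the two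
    m-torsion modules, with inverse lambda up to the unit q modulo m. *)

(** * Linear algebra and arithmetic over the integers *)

(** The saturation of the row lattice of B in Z^N is a direct summand. Here P is
    a projection onto it: B *m P = B says that P fixes the rows of B, and
    m *: P = C *m B that a multiple of its image lies in the row lattice. *)
Lemma int_row_saturation k N (B : 'M[int]_(k, N)) :
  exists (P : 'M[int]_N) (C : 'M[int]_(N, k)) (m : int),
    [/\ m != 0, B *m P = B & m *: P = C *m B].
Proof.
have [U uU [W uW [D _ defB]]] := int_Smith_normal_form B.
set Dm := (\matrix_(i, j) _) in defB.
(* any common multiple of the nonzero elementary divisors works *)
pose m := \prod_(e <- D | e != 0) e.
have m0 : m != 0.
  by rewrite /m; elim/big_rec: _ => // i x i0 x0; rewrite mulf_neq0.
have dvd_m e : e \in D -> e != 0 -> (m %/ e)%Z * e = m.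
  move=> eD e0; apply/eqP; rewrite -dvdz_eq /m.
  by rewrite (big_rem e) //= e0; apply: dvdz_mulr.
pose E := \matrix_(i < N, j < N) (((D`_i != 0) && (i < k)%N)%:R *+ (i == j) : int).
pose D' := \matrix_(i < N, j < k) ((m %/ D`_j)%Z *+ (D`_j != 0) *+ (i == j :> nat)).
(* E projects onto the coordinates carrying a nonzero elementary divisor, and
   D' is an inverse of the diagonal matrix on them, up to the factor m *)
have DE : Dm *m E = Dm.
  apply/matrixP => i j; rewrite !mxE.
  case: (ltnP i N) => iN; last first.
    rewrite big1 => [|t _]; last first.
      by rewrite !mxE (gtn_eqF (leq_trans (ltn_ord t) iN)) mulr0n mul0r.
    by rewrite (gtn_eqF (leq_trans (ltn_ord j) iN)).
  rewrite (bigD1 (Ordinal iN)) //= big1 ?addr0 => [|t ti]; last first.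
    rewrite !mxE [(i == t :> nat)](_ : _ = false) ?mulr0n ?mul0r //.
    by apply: contraNF ti => /eqP ti; apply/eqP/val_inj.
  rewrite !mxE /= eqxx ltn_ord andbT mulr1n -(inj_eq val_inj) /=.
  case: (i == j :> nat); rewrite ?mulr0n ?mulr0 // !mulr1n.
  by case: eqVneq => [->|_]; rewrite ?mulr0 ?mulr1.
have DD : D' *m Dm = m *: E.
  apply/matrixP => i j; rewrite !mxE.
  case: (ltnP i k) => ik; last first.
    rewrite andbF mul0rn mulr0 big1 // => t _; rewrite !mxE.
    by rewrite (gtn_eqF (leq_trans (ltn_ord t) ik)) mulr0n mul0r.
  rewrite (bigD1 (Ordinal ik)) //= big1 ?addr0 => [|t ti]; last first.
    rewrite !mxE [(i == t :> nat)](_ : _ = false) ?mulr0n ?mul0r //.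
    by apply: contraNF ti => /eqP ti; apply/eqP/val_inj.
  rewrite !mxE /= eqxx mulr1n andbT -(inj_eq val_inj) /=.
  case: (i == j :> nat); rewrite ?mulr0n ?mulr0 // !mulr1n.
  case: eqVneq => [->|D0]; rewrite ?mulr0 // mulr1 mulr1n dvd_m //.
  rewrite mem_nth // ltnNge; apply: contra_neqN D0 => sD.
  by rewrite nth_default.
exists (invmx W *m E *m W), (invmx W *m D' *m invmx U), m; split=> //.
  by rewrite defB !mulmxA mulmxK // -[U *m Dm *m E]mulmxA DE.
by rewrite defB !mulmxA mulmxKV // -[_ *m D' *m Dm]mulmxA DD -!scalemxAr -!scalemxAl.
Qed.

(** The choice made in the definition of dim_of is harmless: two bases of the
    same subspace have transition matrices inverse to each other. *)
Lemma dim_ofE (K : fieldType) (V : lmodType K) (S : set V) k (e : 'I_k -> V) :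
  (forall x, S x <-> exists c : 'I_k -> K, x = \sum_i c i *: e i) ->
  (forall c : 'I_k -> K, \sum_i c i *: e i = 0 -> forall i, c i = 0) ->
  dim_of S = k.
Proof.
have size_le p q (f : 'I_p -> V) (g : 'I_q -> V) :
    (forall x, S x <-> exists c : 'I_p -> K, x = \sum_i c i *: f i) ->
    (forall c : 'I_p -> K, \sum_i c i *: f i = 0 -> forall i, c i = 0) ->
    (forall x, S x <-> exists c : 'I_q -> K, x = \sum_i c i *: g i) ->
    (p <= q)%N.
  move=> fS ffree gS.
  have fin i : S (f i).
    apply/fS; exists (fun j => (i == j)%:R).
    rewrite (bigD1 i) //= eqxx scale1r big1 ?addr0 // => j /negbTE.
    by rewrite eq_sym => ->; rewrite scale0r.
  have gin i : S (g i).
    apply/gS; exists (fun j => (i == j)%:R).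
    rewrite (bigD1 i) //= eqxx scale1r big1 ?addr0 // => j /negbTE.
    by rewrite eq_sym => ->; rewrite scale0r.
  have /choice[X fX] : forall i, exists c : 'I_q -> K, f i = \sum_j c j *: g j.
    by move=> i; apply/gS.
  have /choice[Y gY] : forall i, exists c : 'I_p -> K, g i = \sum_j c j *: f j.
    by move=> i; apply/fS.
  pose MX : 'M[K]_(p, q) := \matrix_(i, j) X i j.
  pose MY : 'M[K]_(q, p) := \matrix_(i, j) Y i j.
  apply: (@mulmx1_min _ _ _ MX MY); apply/matrixP => i j.
  apply/eqP; rewrite -subr_eq0; apply/eqP.
  have := ffree (fun j => (MX *m MY) i j - (1%:M : 'M[K]_p) i j); apply.
  under eq_bigr do rewrite scalerBl.
  rewrite sumrB [X in _ - X](_ : _ = f i); last first.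
    rewrite (bigD1 i) //= mxE eqxx scale1r big1 ?addr0 // => t /negbTE.
    by rewrite mxE eq_sym => ->; rewrite scale0r.
  apply/eqP; rewrite subr_eq0; apply/eqP; rewrite fX.
  under [RHS]eq_bigr do rewrite gY scaler_sumr.
  rewrite exchange_big /=; apply: eq_bigr => t _.
  by rewrite !mxE scaler_suml; apply: eq_bigr => s _; rewrite !mxE scalerA.
move=> eS efree; rewrite /dim_of; set X := mkset _.
have Xk : X k by exists e.
have [g [gS gfree]] : X (get X) by apply: getI Xk.
by apply/eqP; rewrite eqn_leq (size_le _ _ g e) // (size_le _ _ e g).
Qed.

(** A primitive binary quadratic form represents integers prime to any given m.
    At a prime p dividing m, the value is congruent to a x^2, c y^2 or - b x y
    when only the corresponding variables are nonzero modulo p; x and y are the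
    products of the primes at which they have to vanish. *)
Lemma coprime_value (a b c : int) (m : nat) : (0 < m)%N ->
  (forall p, prime p -> (p%:Z %| a)%Z -> (p%:Z %| b)%Z -> (p%:Z %| c)%Z -> False) ->
  exists x y : int, coprime (absz (a * x ^+ 2 - b * x * y + c * y ^+ 2)) m.
Proof.
move=> m0 prim.
have dvdP p (Q : pred nat) : prime p -> (p %| m)%N ->
    (p %| \prod_(e <- primes m | Q e) e)%N = Q p.
  move=> pp pm; apply/idP/idP; last first.
    move=> Qp; rewrite (big_rem p) /= ?Qp ?dvdn_mulr //.
    by rewrite mem_primes pp m0.
  rewrite big_seq_cond; elim/big_rec: _ => [|e x /andP[ein Qe] IH].
    by rewrite dvdn1 => /eqP p1; rewrite p1 in pp.
  rewrite Euclid_dvdM // => /orP[|//]; move: ein; rewrite mem_primes.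
  by case/and3P=> pe _ _; rewrite dvdn_prime2 // => /eqP->.
pose dv (t : int) (p : nat) := (p %| `|t|)%N.
pose y := (\prod_(e <- primes m | ~~ dv a e) e)%N.
pose x := (\prod_(e <- primes m | dv a e && ~~ dv c e) e)%N.
exists x%:Z, y%:Z.
set f := (X in absz X).
have {}f0 p : prime p -> (p %| m)%N -> ~~ (p %| absz f)%N.
  move=> pp pm; apply/negP => pf.
  have dx : (p%:Z %| x%:Z)%Z = dv a p && ~~ dv c p by rewrite -(dvdP p (fun e => dv a e && ~~ dv c e)).
  have dy : (p%:Z %| y%:Z)%Z = ~~ dv a p by rewrite -(dvdP p (fun e => ~~ dv a e)).
  have dM u v : (p%:Z %| u * v)%Z = (p%:Z %| u)%Z || (p%:Z %| v)%Z.
    by rewrite !dvdzE abszM Euclid_dvdM.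
  have dD s t : (p%:Z %| s)%Z -> (p%:Z %| s + t)%Z = (p%:Z %| t)%Z.
    by move=> ps; apply/idP/idP => pt; [rewrite -(addKr s t) addrC rpredB | rewrite rpredD].
  have {pf} : (p%:Z %| f)%Z by [].
  rewrite /f !expr2.
  (* p does not divide a: then p divides y but not x *)
  have [ap|ap] := boolP (dv a p); rewrite ?ap ?(negbTE ap) /= in dx dy; last first.
    rewrite addrAC -addrA addrC -addrA dD ?dD ?rpredN ?dM ?dx ?dy ?orbT ?orbF //.
    by apply/negP.
  (* p divides a and c, hence not b: then p divides neither x nor y *)
  have [cp|cp] := boolP (dv c p); rewrite cp /= in dx.
    rewrite addrAC dD ?rpredD ?rpredN ?dM ?[(_ %| a)%Z]ap ?[(_ %| c)%Z]cp //.
    by rewrite dx dy !orbF => bp; exact: (prim p).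
  (* p divides a but not c: then p divides x but not y *)
  rewrite dD ?rpredB ?dM ?dx ?dy ?orbT // !orbF.
  by apply/negP.
rewrite coprime_sym /coprime; apply: contraT => g1.
have pp := pdiv_prime (_ : 1 < gcdn m `|f|)%N.
have g2 : (1 < gcdn m `|f|)%N by rewrite ltn_neqAle eq_sym g1 gcdn_gt0 m0.
have := pdiv_dvd (gcdn m `|f|); rewrite dvdn_gcd => /andP[d1 d2].
by move: (f0 _ (pp g2) d1); rewrite d2.
Qed.

(** * Rank over the fraction field and over a larger field *)

Section FractionLift.
Variables (D : idomainType) (F : fieldType) (f : {rmorphism D -> F}).
Hypothesis f_inj : injective f.

Lemma frac_ratio (u : {fraction D}) :
  u * FracField.tofrac \d_(repr u) = FracField.tofrac \n_(repr u).
Proof.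
elim/quotW: u => x; rewrite !piE.
apply/eqmodP; rewrite /= FracField.equivfE /FracField.mulf.
by rewrite !numden_Ratio ?mulf_neq0 ?oner_neq0 ?denom_ratioP // !mulr1
  FracField.equivf_r.
Qed.

(** The value on the representative chosen by the quotient; by frac_lift_eq
    any other fraction gives the same value. *)
Definition frac_lift (u : {fraction D}) : F := f \n_(repr u) / f \d_(repr u).

Let f_neq0 x : x != 0 -> f x != 0.
Proof. by apply: contra_neq => fx; apply: f_inj; rewrite fx rmorph0. Qed.

Let fd_neq0 (x : ratio D) : f \d_x != 0.
Proof. exact: f_neq0 (denom_ratioP x). Qed.

Lemma frac_lift_eq u n d : d != 0 ->
  u * FracField.tofrac d = FracField.tofrac n -> frac_lift u = f n / f d.
Proof.
move=> d0 ud; apply/eqP; rewrite eqr_div ?fd_neq0 ?f_neq0 // -!rmorphM.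
by apply/eqP; congr (f _); apply/eqP; rewrite -tofrac_eq !rmorphM /= -frac_ratio
  -ud; apply/eqP; ring.
Qed.

Lemma frac_lift_zmod : zmod_morphism frac_lift.
Proof.
move=> x y.
rewrite (@frac_lift_eq _ (\n_(repr x) * \d_(repr y) - \n_(repr y) * \d_(repr x))
   (\d_(repr x) * \d_(repr y))); last 2 first.
- by rewrite mulf_neq0 ?denom_ratioP.
- by rewrite rmorphB !rmorphM /= -!frac_ratio; ring.
by rewrite rmorphB !rmorphM /frac_lift; field; rewrite !fd_neq0.
Qed.

Lemma frac_lift_monoid : monoid_morphism frac_lift.
Proof.
split.
  by rewrite (@frac_lift_eq _ 1 1) ?oner_neq0 ?mul1r // rmorph1 divr1.
move=> x y; rewrite (@frac_lift_eq _ (\n_(repr x) * \n_(repr y))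
   (\d_(repr x) * \d_(repr y))); last 2 first.
- by rewrite mulf_neq0 ?denom_ratioP.
- by rewrite !rmorphM /= -!frac_ratio; ring.
by rewrite !rmorphM /frac_lift; field; rewrite !fd_neq0.
Qed.

HB.instance Definition _ := GRing.isZmodMorphism.Build {fraction D} F frac_lift
  frac_lift_zmod.
HB.instance Definition _ := GRing.isMonoidMorphism.Build {fraction D} F frac_lift
  frac_lift_monoid.

Lemma frac_lift_tofrac x : frac_lift (FracField.tofrac x) = f x.
Proof.
by rewrite (@frac_lift_eq _ x 1) ?oner_neq0 ?rmorph1 ?mulr1 // divr1.
Qed.

(** An embedding of D in a field F extends to the fraction field, and the rank of a
    matrix is invariant under field extension. *)
Lemma rank_tofrac m n (A : 'M[D]_(m, n)) :
  \rank (map_mx (@FracField.tofrac D) A) = \rank (map_mx f A).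
Proof.
rewrite -(mxrank_map frac_lift) -map_mx_comp; congr (\rank _).
by apply: eq_map_mx => x /=; exact: frac_lift_tofrac.
Qed.

End FractionLift.

Lemma pi_quotmod0 (T : nzRingType) (W : lmodType T) (N : submodClosed W) :
  \pi_(quotmod N) 0 = 0.
Proof. exact: (raddf0 (\pi_(Quotient.quot (submod_pred N)))). Qed.

(** * The generic rank of a realized module *)

Section GenericRank.
Variables (D : idomainType) (d n : nat) (v : 'I_n -> 'rV[D]_d) (A : {set 'I_n}).
Local Notation K := {fraction D}.
Local Notation tofrac := (@FracField.tofrac D).
Local Notation M := (realized_module v A).
Local Notation e := (fun x : M => << x >> : {freeg M / K}).
Local Notation cl := (\pi_(quotmod (in_span (@tensor_rel D M)))).

(** Rows outside A are filled with 0 so that all subsets share the same index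
    type; this changes neither the row span nor the rank. *)
Definition relation_mx (T : nzRingType) (w : 'I_n -> 'rV[T]_d) : 'M[T]_(n, d) :=
  \matrix_(i < n) (if i \in A then w i else 0).

Lemma in_span_rel (x : 'rV[D]_d) :
  x \in in_span (v @` [set` A])%classic -> exists c, x = c *m relation_mx v.
Proof.
case/asboolP=> k [c [s [sA ->]]].
elim/big_ind: _ => [|_ _ [p ->] [q ->]|i _].
- by exists 0; rewrite mul0mx.
- by exists (p + q); rewrite mulmxDl.
have [j jA <-] := sA i; exists (c i *: delta_mx 0 j).
by rewrite -scalemxAl -rowE rowK [j \in A]jA.
Qed.

Lemma mul_rel_in_span (c : 'rV[D]_n) :
  c *m relation_mx v \in in_span (v @` [set` A])%classic.
Proof.
rewrite mulmx_sum_row; apply: rpred_sum => i _; rewrite rpredZ // rowK.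
case: ifP => iA; last exact: rpred0.
apply/asboolP; exists 1, (fun=> 1), (fun=> v i); split; first by exists i.
by rewrite big_ord1 scale1r.
Qed.

Lemma tensor_classD x y : cl (e (x + y)) = cl (e x) + cl (e y).
Proof.
rewrite -pi_quotmodD; apply/pi_quotmodP.
apply/asboolP; exists 1, (fun=> 1), (fun=> e (x + y) - e x - e y); split.
  by left; exists x, y.
by rewrite big_ord1 scale1r opprD addrA.
Qed.

Lemma tensor_classZ (a : D) x : cl (e (a *: x)) = tofrac a *: cl (e x).
Proof.
rewrite -[RHS]pi_quotmodZ; apply/pi_quotmodP.
apply/asboolP; exists 1, (fun=> 1), (fun=> e (a *: x) - tofrac a *: e x); split.
  by right; exists a, x.
by rewrite big_ord1 scale1r.
Qed.

Lemma tensor_class0 : cl (e 0) = 0.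
Proof. by have := tensor_classZ 0 0; rewrite scaler0 rmorph0 scale0r. Qed.

Local Notation cls := (\pi_M : 'rV[D]_d -> M).
Local Notation V := (map_mx tofrac (relation_mx v)).
Local Notation frow := (map_mx tofrac : 'rV[D]_d -> 'rV[K]_d).

(** The map from K^d to the tensor product induced by D^d -> M. It is onto
    (tensor_spanned) and its kernel is the row space of the relations: it
    contains it by extend_row_relation, and the equality is detected by the
    maps eval_tensor below. *)
Definition extend_row (y : 'rV[K]_d) : tensor_frac M :=
  \sum_j y 0 j *: cl (e (cls (delta_mx 0 j))).

Lemma extend_row_linear : linear extend_row.
Proof.
move=> c x y; rewrite /extend_row scaler_sumr -big_split; apply: eq_bigr => j _ /=.
by rewrite !mxE scalerDl scalerA.
Qed.
HB.instance Definition _ := GRing.isLinear.Build K 'rV[K]_d (tensor_frac M) _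
  extend_row extend_row_linear.

Lemma cls_sum (x : 'rV[D]_d) :
  cls x = \sum_j x 0 j *: cls (delta_mx 0 j).
Proof.
rewrite {1}(row_sum_delta x).
elim/big_rec2: _ => [|j y1 y2 _ <-]; first exact: pi_quotmod0.
by rewrite pi_quotmodD pi_quotmodZ.
Qed.

Lemma extend_row_frac (x : 'rV[D]_d) : extend_row (frow x) = cl (e (cls x)).
Proof.
rewrite /extend_row [in RHS]cls_sum.
elim/big_rec2: _ => [|j y1 y2 _ ->].
  by rewrite tensor_class0.
by rewrite tensor_classD tensor_classZ mxE.
Qed.

Section Evaluation.
Variables (k : nat) (Q : 'M[K]_(d, k)).
Hypothesis VQ0 : V *m Q = 0.

(** A matrix Q killing the relations induces a linear map from the tensor product
    to K^k. It is built in three stages, on M, on the free module over M, and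
    on the quotient of the latter. *)
Definition eval_class (x : M) : 'rV[K]_k := frow (repr x) *m Q.

Lemma eval_classE (x : 'rV[D]_d) : eval_class (cls x) = frow x *m Q.
Proof.
apply/eqP; rewrite -subr_eq0 -mulmxBl -map_mxB.
have /in_span_rel[c ->] : repr (cls x) - x \in in_span (v @` [set` A])%classic.
  by apply/pi_quotmodP; rewrite reprK.
by rewrite map_mxM -mulmxA VQ0 mulmx0.
Qed.

Definition eval_freeg (u : {freeg M / K}) : 'rV[K]_k := fglift eval_class u.

HB.instance Definition _ := GRing.isZmodMorphism.Build _ _ eval_freeg
  (@lift_is_additive K M 'rV[K]_k eval_class).

Lemma eval_freegU c x : eval_freeg << c *g x >> = c *: eval_class x.
Proof. exact: liftU. Qed.

Lemma eval_freegZ : scalable eval_freeg.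
Proof.
move=> c u.
have -> : c *: u = \sum_(x <- dom u) << c * coeff x u *g x >> by [].
rewrite -[in RHS](freeg_sumE u) !raddf_sum /=; apply: eq_bigr => x _.
by rewrite !eval_freegU scalerA.
Qed.
HB.instance Definition _ := GRing.isScalable.Build K _ _ _ eval_freeg eval_freegZ.

Lemma eval_freeg_rel u : u \in in_span (@tensor_rel D M) -> eval_freeg u = 0.
Proof.
case/asboolP=> p [c [s [sR ->]]]; rewrite linear_sum big1 // => i _.
rewrite linearZ /=; suff -> : eval_freeg (s i) = 0 by rewrite scaler0.
case: (sR i) => [[x [y ->]]|[a [x ->]]].
  rewrite !raddfB /= !eval_freegU !scale1r -[x]reprK -[y]reprK -pi_quotmodD.
  by rewrite !eval_classE map_mxD mulmxDl -addrA -opprD subrr.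
rewrite raddfB /= linearZ /= !eval_freegU !scale1r -[x]reprK.
rewrite [_ *: _](esym (pi_quotmodZ _ _ _)) !eval_classE.
by rewrite map_mxZ -scalemxAl subrr.
Qed.

Definition eval_tensor (t : tensor_frac M) : 'rV[K]_k := eval_freeg (repr t).

Lemma eval_tensorE u : eval_tensor (cl u) = eval_freeg u.
Proof.
apply/eqP; rewrite -subr_eq0 -raddfB; apply/eqP/eval_freeg_rel.
by apply/pi_quotmodP; rewrite reprK.
Qed.

Lemma eval_extend_row y : eval_tensor (extend_row y) = y *m Q.
Proof.
have -> : extend_row y = cl (\sum_j y 0 j *: e (cls (delta_mx 0 j))).
  rewrite /extend_row; elim/big_rec2: _ => [|j y1 y2 _ ->].
    by rewrite pi_quotmod0.
  by rewrite pi_quotmodD pi_quotmodZ.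
rewrite eval_tensorE linear_sum [y in RHS]row_sum_delta mulmx_suml.
apply: eq_bigr => j _; rewrite linearZ /= eval_freegU scale1r eval_classE.
by rewrite map_delta_mx scalemxAl.
Qed.

End Evaluation.

Lemma tensor_spanned (t : tensor_frac M) : exists y, t = extend_row y.
Proof.
rewrite -[t]reprK -[repr t]freeg_sumE.
elim/big_rec: _ => [|x u _ [y IH]].
  by exists 0; rewrite linear0 pi_quotmod0.
exists (coeff x (repr t) *: frow (repr x) + y).
rewrite linearD linearZ /= extend_row_frac reprK -IH pi_quotmodD; congr (_ + _).
rewrite -[RHS]pi_quotmodZ; congr (cl _).
by apply/eqP/freeg_eqP => z; rewrite coeffZ !coeffU mul1r.
Qed.

Lemma extend_row_relation (y : 'rV[K]_d) : (y <= V)%MS -> extend_row y = 0.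
Proof.
case/submxP=> c ->; rewrite mulmx_sum_row linear_sum big1 // => i _.
rewrite linearZ /= -map_row extend_row_frac.
have -> : cls (row i (relation_mx v)) = 0.
  rewrite -[RHS]pi_quotmod0; apply/pi_quotmodP; rewrite subr0 rowE.
  exact: mul_rel_in_span.
by rewrite tensor_class0 scaler0.
Qed.

(** Right exactness of the tensor product: the dimension is that of the cokernel
    of the relation matrix. With Q a full-rank matrix whose kernel is the row
    space of V and Q' a section of it, the rows of Q' give a basis. *)
Lemma generic_rank_realized :
  generic_rank M = (d - \rank V)%N.
Proof.
rewrite -mxrank_coker; set k := \rank _.
pose Q : 'M[K]_(d, k) := col_base (cokermx V).
have QE (y : 'rV[K]_d) : y *m Q = 0 -> (y <= V)%MS.
  by move=> yQ; rewrite submxE -(mulmx_base (cokermx V)) mulmxA yQ mul0mx.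
have VQ0 : V *m Q = 0.
  apply: (row_free_inj (row_base_free (cokermx V))).
  by rewrite mul0mx -mulmxA mulmx_base mulmx_coker.
have /row_fullP[Q' Q'Q] : row_full Q by exact: col_base_full.
pose b (i : 'I_k) := extend_row (row i Q').
have bE (c : 'I_k -> K) : \sum_i c i *: b i = extend_row ((\row_i c i) *m Q').
  rewrite mulmx_sum_row linear_sum; apply: eq_bigr => i _.
  by rewrite linearZ /= mxE.
apply: (@dim_ofE _ _ _ _ b) => [t|c]; last first.
  rewrite bE => /(congr1 (eval_tensor Q)).
  rewrite (eval_extend_row VQ0) -mulmxA Q'Q mulmx1 -(linear0 extend_row).
  rewrite (eval_extend_row VQ0) mul0mx => /rowP c0 i.
  by have := c0 i; rewrite !mxE.
split=> // _; have [y ->] := tensor_spanned t.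
exists (fun i => (y *m Q) 0 i); rewrite bE.
rewrite (_ : \row_i _ = y *m Q); last by apply/rowP => i; rewrite mxE.
apply/eqP; rewrite -subr_eq0 -linearB; apply/eqP/extend_row_relation/QE.
by rewrite mulmxBl -!mulmxA Q'Q mulmx1 subrr.
Qed.

End GenericRank.

(** * Cardinalities of images *)

(** Two maps on X with the same fibres have images in bijection; when these are
    infinite, card_set is 0 on both sides. *)
Lemma card_set_image_eq (T U V : choiceType) (X : set T) (x0 : T)
    (p : T -> U) (h : T -> V) :
  (forall x y, X x -> X y -> p x = p y <-> h x = h y) ->
  card_set (p @` X)%classic = card_set (h @` X)%classic.
Proof.
move=> ph.
pose f u := h (xget x0 [set x | X x /\ p x = u]%classic).
have fp x : X x -> f (p x) = h x.
  move=> Xx; rewrite /f; case: xgetP => [y _ [Xy pxy]|/(_ x)]; first exact/(ph y x).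
  by case.
have card_hp : (h @` X #= p @` X)%card.
  have -> : (h @` X = f @` (p @` X))%classic.
    rewrite eqEsubset; split=> [_ [x Xx <-]|_ [_ [x Xx <-] <-]].
      by exists (p x); [exists x | exact: fp].
    by exists x; rewrite ?fp.
  apply: inj_card_eq => _ _ /set_mem[x Xx <-] /set_mem[y Xy <-].
  by rewrite !fp // => hxy; apply/(ph x y).
rewrite /card_set; have [fin|inf] := pselect (finite_set (p @` X)%classic).
  by apply/esym/fcard_eq => //; rewrite (eq_finite_set card_hp).
have inf' : ~ finite_set (h @` X)%classic by rewrite (eq_finite_set card_hp).
by rewrite /fset_set; case: pselect => // _; case: pselect.
Qed.

(** * The order of complex multiplication *)

Lemma quadratic_equation (R : realType) (w : R[i]) : quadratic_over_Q w ->
  exists a b c : int,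
    a%:~R * w ^+ 2 + b%:~R * w + c%:~R = 0 /\
    exists x y z : int, x * a + y * b + z * c = 1.
Proof.
case=> p [_ sp pw]; have [q [k k0 pE]] := rat_poly_scale p.
have k0' : (k%:~R : rat)^-1 != 0 by rewrite invr_eq0 intr_eq0.
have sq : size q = 3%N by rewrite -sp pE size_scale // size_rat_int_poly.
have q2 : q`_2 != 0.
  by have := lead_coef_eq0 q; rewrite -size_poly_eq0 /lead_coef sq /= => ->.
have qw : (q`_2)%:~R * w ^+ 2 + (q`_1)%:~R * w + (q`_0)%:~R = 0.
  move: pw; rewrite pE map_polyZ rootZ ?fmorph_eq0 // => /rootP.
  rewrite -map_poly_comp (@horner_coef_wide _ 3); last first.
    by rewrite (leq_trans (size_poly _ _)) // sq.
  rewrite !big_ord_recl big_ord0 !coef_map_id0 ?rmorph0 //= => <-.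
  by rewrite !ratr_int expr0 expr1 /bump /=; ring.
have [x [y xy]] := Bezoutz q`_2 q`_1.
set g := gcdz _ _ in xy; have [s [t st]] := Bezoutz g q`_0.
set e := gcdz _ _ in st.
have e0 : e != 0 by rewrite gcdz_eq0 gcdz_eq0 (negbTE q2).
have de2 : (e %| q`_2)%Z by rewrite (dvdz_trans (dvdz_gcdl _ _)) ?dvdz_gcdl.
have de1 : (e %| q`_1)%Z by rewrite (dvdz_trans (dvdz_gcdl _ _)) ?dvdz_gcdr.
have de0 : (e %| q`_0)%Z by rewrite dvdz_gcdr.
move: (divzK de2) (divzK de1) (divzK de0) => E2 E1 E0.
exists (q`_2 %/ e)%Z, (q`_1 %/ e)%Z, (q`_0 %/ e)%Z; split.
  have eC : e%:~R != 0 :> R[i] by rewrite intr_eq0.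
  apply: (mulfI eC); rewrite mulr0 -qw -{2}E2 -{2}E1 -{2}E0 !rmorphM /=; ring.
exists (s * x), (s * y), t; apply: (mulfI e0).
by rewrite mulr1 -[RHS]st -xy -{2}E2 -{2}E1 -{2}E0; ring.
Qed.

(** Otherwise the whole lattice would be contained in the real line, and could
    not span C. *)
Lemma lattice_not_real (R : realType) (L : zmodClosed R[i]) (w : R[i]) :
  is_lattice L ->
  (forall z, z \in L <-> exists a b : int, z = a%:~R + b%:~R * w) ->
  complex.Im w != 0.
Proof.
case=> u [v [Luv _ Lspan]] Lw; apply/eqP => w0.
have Im_int (k : int) : complex.Im (k%:~R : R[i]) = 0.
  by rewrite -(rmorph_int (real_complex R)).
have ImL z : z \in L -> complex.Im z = 0.
  case/Lw=> k [m ->]; rewrite raddfD /= Im_int add0r.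
  rewrite -(rmorph_int (real_complex R)); case: w w0 {Lw} => wr wi /= ->.
  by rewrite mulr0 mul0r addr0.
have uL : u \in L by apply/Luv; exists 1, 0; rewrite mul1r mul0r addr0.
have vL : v \in L by apply/Luv; exists 0, 1; rewrite mul1r mul0r add0r.
have [s [t ]] := Lspan ('i%C).
move: (ImL u uL) (ImL v vL); case: u {Luv Lspan uL} => ur ui; case: v {vL} => vr vi.
move=> /= -> -> /(congr1 (@complex.Im R)) /=.
by rewrite !mulr0 !mul0r !addr0; apply/eqP; rewrite oner_eq0.
Qed.

Section CMOrder.
Variables (R : realType) (L : zmodClosed R[i]) (w : R[i]) (a b c : int).
Hypothesis L_gen : forall z, z \in L <-> exists x y : int, z = x%:~R + y%:~R * w.
Hypothesis w_notreal : complex.Im w != 0.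
Hypothesis w_root : a%:~R * w ^+ 2 + b%:~R * w + c%:~R = 0.
Hypothesis abc_coprime : exists x y z : int, x * a + y * b + z * c = 1.

Local Notation C := R[i].
Local Notation O := (endE L).
Local Notation Re := (@complex.Re R).
Local Notation Im := (@complex.Im R).

Lemma a_neq0 : a != 0.
Proof.
apply/eqP => a0; move: w_root; rewrite a0 mul0r add0r.
case: w w_notreal => wr wi /= wi0.
rewrite -!(rmorph_int (real_complex R)) => /eqP; rewrite eq_complex /=.
rewrite !mul0r !addr0 subr0 mulf_eq0 (negbTE wi0) orbF intr_eq0.
case/andP=> bw /eqP b0; move: bw; rewrite b0 mul0r add0r intr_eq0 => /eqP c0.
by have [x [y [z]]] := abc_coprime; rewrite a0 b0 c0 !mulr0.
Qed.

(** With a w^2 + b w + c = 0 primitive, the order is Z + Z a w, see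
    preserves_latticeE. *)
Definition tau : C := a%:~R * w.

Lemma Im_tau : Im tau = a%:~R * Im w.
Proof.
by rewrite /tau -(rmorph_int (real_complex R)); case: w => wr wi /=; rewrite mul0r addr0.
Qed.

Lemma Im_tau_neq0 : Im tau != 0.
Proof. by rewrite Im_tau mulf_neq0 // intr_eq0 a_neq0. Qed.

Lemma tau_sqr : tau * tau = - b%:~R * tau - (a * c)%:~R.
Proof.
have -> : tau * tau = a%:~R * (a%:~R * w ^+ 2 + b%:~R * w + c%:~R)
    + (- b%:~R * tau - (a * c)%:~R).
  by rewrite /tau rmorphM /=; ring.
by rewrite w_root mulr0 add0r.
Qed.

(** The coordinates of z in the real basis (1, tau) of C are one_coord z and
    tau_coord z. *)
Definition tau_coord (z : C) : R := Im z / Im tau.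
Definition one_coord (z : C) : R := Re z - tau_coord z * Re tau.

Lemma coordsE z : z = (one_coord z)%:C%C + (tau_coord z)%:C%C * tau.
Proof.
rewrite /one_coord /tau_coord; move: Im_tau_neq0; case: tau => tr ti /= ti0.
case: z => x y; apply/eqP; rewrite eq_complex /= !mul0r subr0 addr0 add0r subrK.
by rewrite divfK ?eqxx.
Qed.

Lemma tau_coord_zmod : zmod_morphism tau_coord.
Proof. by move=> x y; rewrite /tau_coord raddfB mulrBl. Qed.
HB.instance Definition _ := GRing.isZmodMorphism.Build C R tau_coord tau_coord_zmod.

Lemma one_coord_zmod : zmod_morphism one_coord.
Proof. by move=> x y; rewrite /one_coord !raddfB /= mulrBl; ring. Qed.
HB.instance Definition _ := GRing.isZmodMorphism.Build C R one_coord one_coord_zmod.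

Lemma tau_coordE (x y : R) : tau_coord (x%:C%C + y%:C%C * tau) = y.
Proof.
rewrite /tau_coord; move: Im_tau_neq0; case: tau => tr ti /= ti0.
by rewrite mul0r addr0 add0r mulfK.
Qed.

Lemma one_coordE (x y : R) : one_coord (x%:C%C + y%:C%C * tau) = x.
Proof.
by rewrite /one_coord tau_coordE; case: tau => tr ti /=; rewrite mul0r subr0 addrK.
Qed.

Lemma tau_coord_intE (x y : int) : tau_coord (x%:~R + y%:~R * tau) = y%:~R.
Proof. by rewrite -!(rmorph_int (real_complex R)) tau_coordE. Qed.

Lemma one_coord_intE (x y : int) : one_coord (x%:~R + y%:~R * tau) = x%:~R.
Proof. by rewrite -!(rmorph_int (real_complex R)) one_coordE. Qed.

(** Multiplication by tau turns the coordinate along 1 into the coordinate along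
    tau: the form tau_coord generates the O-module of Z-linear forms on O. *)
Lemma tau_coordM_tau z : tau_coord (tau * z) = one_coord z - b%:~R * tau_coord z.
Proof.
rewrite {1}(coordsE z) -[RHS](tau_coordE (- ((a * c)%:~R * tau_coord z))); congr tau_coord.
have -> : tau * ((one_coord z)%:C%C + (tau_coord z)%:C%C * tau) =
  (one_coord z)%:C%C * tau + (tau_coord z)%:C%C * (tau * tau) by ring.
rewrite tau_sqr !(rmorphB, rmorphN, rmorphM, rmorph_int) /=; ring.
Qed.

(** The stabilizer of L is Z + Z a w. If z = x + y w stabilizes L then z w is in L
    as well, so y w^2 is in L and a divides y b and y c; as a, b, c are coprime,
    a divides y. *)
Lemma preserves_latticeE z : z \in preserves_lattice L <->
  exists x y : int, z = x%:~R + y%:~R * tau.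
Proof.
split=> [/asboolP zL|[x [y ->]]]; last first.
  apply/asboolP => _ /L_gen[p [q ->]]; apply/L_gen.
  exists (x * p - y * q * c), (x * q + y * a * p - y * q * b).
  have -> : (x%:~R + y%:~R * tau) * (p%:~R + q%:~R * w) =
     x%:~R * p%:~R + x%:~R * q%:~R * w + y%:~R * p%:~R * a%:~R * w
     + y%:~R * q%:~R * ((a%:~R * w ^+ 2 + b%:~R * w + c%:~R) - (b%:~R * w + c%:~R)) :> C.
    by rewrite /tau; ring.
  by rewrite w_root !(rmorphB, rmorphD, rmorphM) /=; ring.
have /L_gen[x [y zE]] : z \in L.
  by rewrite -[z]mulr1; apply: zL; apply/L_gen; exists 1, 0; rewrite mul0r addr0.
have /L_gen[p [q zwE]] : z * w \in L.
  by apply: zL; apply/L_gen; exists 0, 1; rewrite mul1r add0r.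
have E : y%:~R * (- b%:~R * w - c%:~R) + a%:~R * x%:~R * w
       = a%:~R * p%:~R + a%:~R * q%:~R * w :> C.
  have -> : a%:~R * p%:~R + a%:~R * q%:~R * w = a%:~R * (z * w) by rewrite zwE; ring.
  have -> : - b%:~R * w - c%:~R = a%:~R * w ^+ 2 - (a%:~R * w ^+ 2 + b%:~R * w + c%:~R) by ring.
  by rewrite w_root zE; ring.
have wfree (s t : int) : s%:~R + t%:~R * w = 0 :> C -> s = 0 /\ t = 0.
  rewrite -!(rmorph_int (real_complex R)); move: w_notreal; case: w => wr wi /= wi0.
  move/eqP; rewrite eq_complex /= !mul0r subr0 addr0 add0r mulf_eq0 (negbTE wi0) orbF.
  case/andP=> s0 t0; move: t0 s0; rewrite intr_eq0 => /eqP->.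
  by rewrite mul0r addr0 intr_eq0 => /eqP->.
have [yc yb] : y * c + a * p = 0 /\ y * b - a * x + a * q = 0.
  apply: wfree; rewrite !(rmorphB, rmorphD, rmorphM) /=.
  move: E; set lhs := LHS; set rhs := RHS => E.
  apply/eqP; rewrite -(subrr rhs) -{2}E /lhs /rhs; apply/eqP; ring.
have [s [t [r str]]] := abc_coprime.
have yE : y = a * (s * y + t * (x - q) - r * p).
  rewrite -[LHS]mulr1 -str -[LHS]addr0 -(mulr0 (- r)) -yc -[LHS]addr0 -(mulr0 (- t)) -yb.
  ring.
exists x, (s * y + t * (x - q) - r * p).
by rewrite zE /tau {1}yE rmorphM /=; ring.
Qed.

Lemma preserves_lattice_int z :
  (z \in preserves_lattice L) = (one_coord z \is a Num.int) && (tau_coord z \is a Num.int).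
Proof.
apply/idP/andP => [/preserves_latticeE[x [y ->]]|[/intrP[x xE] /intrP[y yE]]].
  by rewrite one_coord_intE tau_coord_intE !intr_int.
apply/preserves_latticeE; exists x, y.
by rewrite {1}(coordsE z) xE yE !rmorph_int.
Qed.

Lemma tau_in : tau \in preserves_lattice L.
Proof. by apply/preserves_latticeE; exists 0, 1; rewrite add0r mul1r. Qed.

Definition tauO : O := Sub tau tau_in.

Lemma val_tauO : val tauO = tau. Proof. exact: SubK. Qed.

Lemma val_endE_int (x : int) : val (x%:~R : O) = x%:~R.
Proof. exact: rmorph_int. Qed.

Lemma val_endEM (o p : O) : val (o * p) = val o * val p.
Proof. by []. Qed.

Lemma val_endED (o p : O) : val (o + p) = val o + val p.
Proof. by []. Qed.

Lemma val_endEB (o p : O) : val (o - p) = val o - val p.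
Proof. by []. Qed.

Lemma val_endE_ints (x y : int) : val (x%:~R + y%:~R * tauO : O) = x%:~R + y%:~R * tau.
Proof. by rewrite rmorphD rmorphM !rmorph_int. Qed.

Lemma endE_decomp (o : O) : exists x y : int, o = x%:~R + y%:~R * tauO.
Proof.
have /preserves_latticeE[x [y xyE]] := valP o; exists x, y; apply: val_inj.
by rewrite val_endE_ints xyE.
Qed.

(** The pairing of O with C given by tau_coord is perfect: an element of C is in O,
    or is 0, as soon as its pairing with all of O is integral, or zero. *)
Lemma tau_coord_int z : (forall o : O, tau_coord (val o * z) \is a Num.int) ->
  z \in preserves_lattice L.
Proof.
move=> zint; have := zint 1; have := zint tauO; rewrite val_tauO tau_coordM_tau rmorph1 mul1r.
move=> h1 h2; rewrite preserves_lattice_int h2 andbT.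
by rewrite -(subrK (b%:~R * tau_coord z) (one_coord z)) rpredD // rpredM ?intr_int.
Qed.

Lemma tau_coord_faithful z : (forall o : O, tau_coord (val o * z) = 0) -> z = 0.
Proof.
move=> zint; have := zint 1; have := zint tauO; rewrite val_tauO tau_coordM_tau rmorph1 mul1r.
by move=> h1 h2; rewrite (coordsE z); move: h1; rewrite h2 mulr0 subr0 => ->; rewrite mul0r addr0.
Qed.

(** The inverse of L is Z a + Z (b + a w). Its product with L is
    generated by a, a w, b + a w and (b + a w) w = - c, so it contains a, b, c,
    and hence 1. *)
Lemma lattice_invertible : exists mu1 mu2 : C,
  [/\ mu1 + mu2 * w = 1,
      forall z, z \in L -> mu1 * z \in preserves_lattice L &
      forall z, z \in L -> mu2 * z \in preserves_lattice L].
Proof.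
have [x [y [z xyz]]] := abc_coprime.
have mu1P t : t \in L -> a%:~R * t \in preserves_lattice L.
  case/L_gen=> p [q ->]; apply/preserves_latticeE; exists (a * p), q.
  by rewrite /tau !rmorphM /=; ring.
have mu2P t : t \in L -> (b%:~R + tau) * t \in preserves_lattice L.
  case/L_gen=> p [q ->]; apply/preserves_latticeE; exists (b * p - q * c), p.
  have -> : (b%:~R + tau) * (p%:~R + q%:~R * w) = b%:~R * p%:~R + p%:~R * tau +
    q%:~R * ((a%:~R * w ^+ 2 + b%:~R * w + c%:~R) - c%:~R) by rewrite /tau; ring.
  by rewrite w_root !(rmorphB, rmorphM) /=; ring.
have intP (n : int) t : t \in preserves_lattice L -> n%:~R * t \in preserves_lattice L.
  by move=> tP; rewrite mulrzl rpredMz.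
exists (x%:~R * a%:~R + y%:~R * (b%:~R + tau)),
       (- y%:~R * a%:~R - z%:~R * (b%:~R + tau)); split.
- have E : x%:~R * a%:~R + y%:~R * b%:~R + z%:~R * c%:~R = 1 :> C.
    by rewrite -!rmorphM -!rmorphD xyz.
  rewrite -[RHS]E.
  have -> : c%:~R = (a%:~R * w ^+ 2 + b%:~R * w + c%:~R) - (a%:~R * w ^+ 2 + b%:~R * w) :> C by ring.
  by rewrite w_root /tau; ring.
- move=> t tL; rewrite mulrDl -!mulrA.
  by apply: rpredD; apply: intP; [exact: mu1P | exact: mu2P].
- move=> t tL; rewrite mulrBl !mulNr -!mulrA.
  by apply: rpredB; rewrite ?rpredN; apply: intP; [exact: mu1P | exact: mu2P].
Qed.

(** Take lambda = x + y w, and mu = a times its conjugate, that is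
    a x - y (b + a w); their product is the norm form of L at (x, y). *)
Lemma lattice_coprime_pair (m : nat) : (0 < m)%N ->
  exists lambda mu (q : int),
    [/\ lambda \in L, forall z, z \in L -> mu * z \in preserves_lattice L,
        mu * lambda = q%:~R & coprime (absz q) m].
Proof.
move=> m0; have [] := @coprime_value a b c m m0.
  have [x [y [z xyz]]] := abc_coprime.
  move=> p pp pa pb pc; have : (p%:Z %| x * a + y * b + z * c)%Z.
    by rewrite !rpredD // dvdz_mull.
  by rewrite xyz dvdzE /= dvdn1 => /eqP p1; rewrite p1 in pp.
move=> x [y xy].
exists (x%:~R + y%:~R * w), (a%:~R * x%:~R - y%:~R * (b%:~R + tau)).
exists (a * x ^+ 2 - b * x * y + c * y ^+ 2); split; last exact: xy.
- by apply/L_gen; exists x, y.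
- move=> _ /L_gen[p [q ->]]; apply/preserves_latticeE.
  exists (a * x * p - y * (b * p - q * c)), (x * q - y * p).
  have -> : (a%:~R * x%:~R - y%:~R * (b%:~R + tau)) * (p%:~R + q%:~R * w) =
    a%:~R * x%:~R * p%:~R + x%:~R * q%:~R * tau - y%:~R * (b%:~R * p%:~R + p%:~R * tau +
    q%:~R * ((a%:~R * w ^+ 2 + b%:~R * w + c%:~R) - c%:~R)) by rewrite /tau; ring.
  by rewrite w_root !(rmorphB, rmorphM) /=; ring.
- have -> : (a%:~R * x%:~R - y%:~R * (b%:~R + tau)) * (x%:~R + y%:~R * w)
    = a%:~R * x%:~R ^+ 2 - b%:~R * x%:~R * y%:~R + c%:~R * y%:~R ^+ 2
      - y%:~R ^+ 2 * (a%:~R * w ^+ 2 + b%:~R * w + c%:~R) by rewrite /tau; ring.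
  by rewrite w_root mulr0 subr0 !(rmorphD, rmorphB, rmorphM) /=; ring.
Qed.

(** * The saturation of a submodule of O^d *)

Section Lattice.
Variable d : nat.
Implicit Types (r s : 'rV[O]_d) (x y : 'rV[C]_d).

(** O^d is generated as a group by the e_j and the tau e_j. *)
Lemma endE_row_ind (P : 'rV[O]_d -> Prop) : P 0 ->
  (forall r s, P r -> P s -> P (r - s)) ->
  (forall j, P (delta_mx 0 j)) -> (forall j, P (tauO *: delta_mx 0 j)) ->
  forall r, P r.
Proof.
move=> P0 PB Pe Pt.
have PN r : P r -> P (- r) by move=> Pr; rewrite -sub0r; apply: PB.
have PD r s : P r -> P s -> P (r + s).
  by move=> Pr Ps; rewrite -[s]opprK; apply: PB => //; apply: PN.
have PMn r k : P r -> P (r *+ k).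
  by move=> Pr; elim: k => [|k IH]; rewrite ?mulr0n // mulrS; apply: PD.
have PMz r (k : int) : P r -> P (r *~ k).
  by move=> Pr; case: k => k; rewrite ?NegzE ?mulrNz; [|apply: PN]; apply: PMn.
move=> r; rewrite [r]row_sum_delta; elim/big_ind: _ => // j _.
have [p [q ->]] := endE_decomp (r 0 j).
rewrite scalerDl -scalerA; apply: PD; rewrite scaler_int; exact: PMz.
Qed.

Definition dot r x : C := \sum_j val (r 0 j) * x 0 j.

Lemma dotBl r s x : dot (r - s) x = dot r x - dot s x.
Proof.
by rewrite /dot -sumrB; apply: eq_bigr => j _; rewrite !mxE rmorphB mulrBl.
Qed.

Lemma dotBr r x y : dot r (x - y) = dot r x - dot r y.
Proof.
by rewrite /dot -sumrB; apply: eq_bigr => j _; rewrite !mxE mulrBr.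
Qed.

Lemma dot0l x : dot 0 x = 0. Proof. by rewrite -(subrr 0) dotBl subrr. Qed.

Lemma dotDl r s x : dot (r + s) x = dot r x + dot s x.
Proof.
by rewrite /dot -big_split; apply: eq_bigr => j _; rewrite !mxE rmorphD mulrDl.
Qed.

Lemma dotDr r x y : dot r (x + y) = dot r x + dot r y.
Proof.
by rewrite /dot -big_split; apply: eq_bigr => j _; rewrite !mxE mulrDr.
Qed.

Lemma dotZl o r x : dot (o *: r) x = val o * dot r x.
Proof.
by rewrite /dot mulr_sumr; apply: eq_bigr => j _; rewrite !mxE rmorphM mulrA.
Qed.

Lemma dotZr r (z : C) x : dot r (z *: x) = z * dot r x.
Proof.
by rewrite /dot mulr_sumr; apply: eq_bigr => j _; rewrite !mxE mulrCA.
Qed.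

Lemma dot_delta j x : dot (delta_mx 0 j) x = x 0 j.
Proof.
rewrite /dot (bigD1 j) //= big1 ?addr0 => [|i ij].
  by rewrite mxE !eqxx rmorph1 mul1r.
by rewrite mxE eqxx (negbTE ij) rmorph0 mul0r.
Qed.

(** The vector y such that tau_coord (r.y) = h r on the generators e_j and tau e_j
    of O^d. *)
Definition coinduced_vec (h : 'rV[O]_d -> R) : 'rV[C]_d := \row_j
  ((h (tauO *: delta_mx 0 j) + b%:~R * h (delta_mx 0 j))%:C%C
    + (h (delta_mx 0 j))%:C%C * tau).

(** Any real-valued additive form on O^d is r |-> tau_coord (r.y) for some y; if h is
    additive only modulo a subgroup J, so is the equality. Used with J = 0 for
    maps into O and J = Z for maps into C / O. *)
Lemma coinduced_vecP (J : R -> Prop) (h : 'rV[O]_d -> R) :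
  J 0 -> (forall t u : R, J t -> J u -> J (t - u)) ->
  (forall r s, J (h (r + s) - h r - h s)) ->
  forall r, J (tau_coord (dot r (coinduced_vec h)) - h r).
Proof.
move=> J0 JB hD.
have JD (t u : R) : J t -> J u -> J (t + u).
  by move=> Jt Ju; rewrite -[u]opprK; apply: (JB) => //; rewrite -sub0r; exact: JB.
apply: endE_row_ind => [|r s Jr Js|j|j].
- by have := hD 0 0; rewrite addr0 subrr sub0r dot0l raddf0 sub0r.
(* subtractivity of h modulo J, from its additivity at (r - s) + s *)
- have -> : tau_coord (dot (r - s) (coinduced_vec h)) - h (r - s) =
     (tau_coord (dot r (coinduced_vec h)) - h r) - (tau_coord (dot s (coinduced_vec h)) - h s)
     + (h ((r - s) + s) - h (r - s) - h s).
    by rewrite dotBl raddfB subrK /=; ring.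
  by apply: JD; [apply: JB|].
- by rewrite dot_delta mxE tau_coordE subrr.
- by rewrite dotZl dot_delta mxE val_tauO tau_coordM_tau tau_coordE one_coordE addrK subrr.
Qed.

Definition int_coords m (r : 'rV[O]_m) : 'rV[int]_(m + m) :=
  row_mx (\row_j Num.floor (one_coord (val (r 0 j)))) (\row_j Num.floor (tau_coord (val (r 0 j)))).

Definition of_int_coords m (s : 'rV[int]_(m + m)) : 'rV[O]_m :=
  \row_j ((s 0 (lshift m j))%:~R + (s 0 (rshift m j))%:~R * tauO).

Lemma int_coordsK m : cancel (@int_coords m) (@of_int_coords m).
Proof.
move=> r; apply/rowP => j; rewrite !mxE (unsplitK (inl _)) (unsplitK (inr _)) !mxE.
have [p [q ->]] := endE_decomp (r 0 j).
by rewrite val_endE_ints one_coord_intE tau_coord_intE !intrKfloor.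
Qed.

Lemma of_int_coordsK m : cancel (@of_int_coords m) (@int_coords m).
Proof.
move=> s; apply/rowP => j; rewrite !mxE; case: splitP => k jk; rewrite !mxE.
  rewrite val_endE_ints one_coord_intE intrKfloor.
  by congr (s _ _); apply: val_inj.
rewrite val_endE_ints tau_coord_intE intrKfloor.
by congr (s _ _); apply: val_inj.
Qed.

Lemma of_int_coords_zmod m : zmod_morphism (@of_int_coords m).
Proof. by move=> r s; apply/rowP => j; rewrite !mxE !rmorphB /=; ring. Qed.
HB.instance Definition _ m := GRing.isZmodMorphism.Build _ _ (@of_int_coords m)
  (@of_int_coords_zmod m).

Lemma int_coords_zmod m : zmod_morphism (@int_coords m).
Proof.
move=> r s; apply: (can_inj (@of_int_coordsK m)).
by rewrite raddfB /= !int_coordsK.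
Qed.
HB.instance Definition _ m := GRing.isZmodMorphism.Build _ _ (@int_coords m)
  (@int_coords_zmod m).

Lemma of_int_coordsZ m (k : int) t :
  of_int_coords (k *: t) = k%:~R *: @of_int_coords m t.
Proof. by rewrite scaler_int -raddfMz -scaler_int intz. Qed.

(** The multiple is the norm, obtained by multiplying by the conjugate of o;
    the conjugate of tau is - b - tau. *)
Lemma endE_int_multiple (o : O) : o != 0 ->
  exists2 p : O, p != 0 & exists2 N : int, N != 0 & p * o = N%:~R.
Proof.
have [x [y ->]] := endE_decomp o => o0.
pose N : int := x * x - b * x * y + a * c * y * y.
pose p : O := (x - b * y)%:~R + (- y)%:~R * tauO.
have pE : p * (x%:~R + y%:~R * tauO) = N%:~R.
  apply: val_inj; rewrite val_endE_int val_endEM !val_endE_ints rmorphN rmorphB rmorphM.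
  have -> : (x%:~R - b%:~R * y%:~R + - y%:~R * tau) * (x%:~R + y%:~R * tau) =
    x%:~R * x%:~R - b%:~R * x%:~R * y%:~R - b%:~R * y%:~R * y%:~R * tau
     - y%:~R * y%:~R * (tau * tau) by ring.
  by rewrite tau_sqr rmorphM /N !(rmorphB, rmorphD, rmorphM) /=; ring.
have p0 : p != 0.
  apply: contra_neq o0 => /(congr1 val); rewrite val_endE_ints rmorph0 => E.
  have := congr1 tau_coord E; have := congr1 one_coord E; rewrite one_coord_intE tau_coord_intE !raddf0.
  move/eqP; rewrite intr_eq0 => /eqP xy /eqP; rewrite intr_eq0 oppr_eq0 => /eqP y0.
  by move: xy; rewrite y0 mulr0 subr0 => ->; rewrite mul0r addr0.
exists p => //; exists N => //.
by apply/eqP => N0; move/eqP: pE; rewrite N0 mulf_eq0 (negbTE p0) (negbTE o0).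
Qed.

Section Saturation.
Variables (n : nat) (v : 'I_n -> 'rV[O]_d) (A : {set 'I_n}).
Local Notation span := (in_span (v @` [set` A])%classic).

(** The set T of these vectors is the preimage in O^d of the torsion of O^d / span,
    see torsion_class. *)
Definition saturated r := exists2 o : O, o != 0 & o *: r \in span.

Lemma saturatedZ o r : saturated r -> saturated (o *: r).
Proof.
by case=> p p0 pr; exists p => //; rewrite scalerA mulrC -scalerA rpredZ.
Qed.

Lemma saturatedD r s : saturated r -> saturated s -> saturated (r + s).
Proof.
case=> p p0 pr [q q0 qs]; exists (p * q); first by rewrite mulf_neq0.
by rewrite scalerDr rpredD //; [rewrite mulrC|]; rewrite -scalerA rpredZ.
Qed.

Lemma saturated_span r : r \in span -> saturated r.
Proof. by exists 1; rewrite ?oner_neq0 ?scale1r. Qed.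

(** The saturation T of the span is a direct summand of O^d as a group, and
    T / span has finite exponent. The projection P is not O-linear. *)
Lemma saturation_projection : exists (P : {additive 'rV[O]_d -> 'rV[O]_d}) (m : nat),
  [/\ (0 < m)%N, forall r, m%:R *: P r \in span
      & forall r, saturated r -> P r = r].
Proof.
pose X := relation_mx A v.
pose B : 'M[int]_(n + n, d + d) :=
  col_mx (\matrix_i int_coords (row i X)) (\matrix_i int_coords (tauO *: row i X)).
have [PM [Q [k [k0 BP kP]]]] := int_row_saturation B.
have BE e : of_int_coords (e *m B) = of_int_coords e *m X.
  rewrite -[e]hsubmxK mul_row_col !mulmx_sum_row -big_split /= raddf_sum.
  apply: eq_bigr => i _; rewrite !rowK raddfD /= !of_int_coordsZ !int_coordsK.
  rewrite scalerA -scalerDl; congr (_ *: _).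
  by rewrite [RHS]mxE row_mxEl row_mxEr.
pose P (r : 'rV[O]_d) := of_int_coords (int_coords r *m PM).
have P_zmod : zmod_morphism P by move=> r s; rewrite /P raddfB mulmxBl raddfB.
pose Pa : {additive 'rV[O]_d -> 'rV[O]_d} :=
  HB.pack P (GRing.isZmodMorphism.Build _ _ P P_zmod).
exists Pa, (absz k); split; first by rewrite absz_gt0.
  move=> r; have kr : k%:~R *: P r \in span.
    rewrite -of_int_coordsZ scalemxAr kP mulmxA BE; exact: mul_rel_in_span.
  have -> : (absz k)%:R *: Pa r = (sgz k)%:~R *: (k%:~R *: P r).
    by rewrite scalerA -intrM -abszEsg -pmulrn.
  exact: rpredZ.
(* P fixes the span, hence T, since a nonzero integer multiple of any element of
   T is in the span and P is additive *)
have Pspan r : r \in span -> P r = r.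
  case/in_span_rel=> e ->; rewrite /P -[e]int_coordsK -BE of_int_coordsK.
  by rewrite -mulmxA BP.
move=> r [o o0 or].
have [p p0 [N N0 pN]] := endE_int_multiple o0.
have Nr : N%:~R *: r \in span by rewrite -pN -scalerA rpredZ.
have : N%:~R *: Pa r = N%:~R *: r.
  by rewrite -[in RHS](Pspan _ Nr) !scaler_int -[P _]/(Pa _) raddfMz.
move=> NPr; apply/rowP => j; apply: (mulfI (_ : N%:~R != 0)).
  by apply: contra_neq N0 => /(congr1 val); rewrite val_endE_int rmorph0 => /eqP;
    rewrite intr_eq0 => /eqP.
by have /rowP/(_ j) := NPr; rewrite !mxE.
Qed.

(** * Extension of linear maps from the saturation *)

Lemma endE_nat_neq0 m : (0 < m)%N -> (m%:R : O) != 0.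
Proof.
move=> m0; apply/eqP => /(congr1 val); rewrite pmulrn val_endE_int rmorph0.
by apply/eqP; rewrite intr_eq0 -lt0n.
Qed.

Lemma tau_coord_lattice_int mu z : (forall t, t \in L -> mu * t \in preserves_lattice L) ->
  z \in L -> tau_coord (mu * z) \is a Num.int.
Proof. by move=> muL /muL; rewrite preserves_lattice_int => /andP[]. Qed.

(** L contains 1 and w. *)
Lemma order_in_lattice z : z \in preserves_lattice L -> z \in L /\ w * z \in L.
Proof.
move/asboolP=> zL; split.
  by rewrite -[z]mulr1; apply: zL; apply/L_gen; exists 1, 0; rewrite mul0r addr0.
by rewrite mulrC; apply: zL; apply/L_gen; exists 0, 1; rewrite mul1r add0r.
Qed.

(** If r.x is in L for r in T, then r |-> r.x is the restriction to T of
    r |-> r.l with l in L^d. *)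
Lemma saturated_lift x : (forall r, saturated r -> dot r x \in L) ->
  exists l : 'rV[C]_d,
    (forall j, l 0 j \in L) /\ (forall r, saturated r -> dot r (x - l) = 0).
Proof.
move=> xL; have [P [m [m0 mP Psat]]] := saturation_projection.
have satP r : saturated (P r) by exists m%:R; [exact: endE_nat_neq0 | exact: mP].
have [mu1 [mu2 [mu12 mu1L mu2L]]] := lattice_invertible.
(* the map r |-> mu (r.x) on T has values in O; extend its coefficient of tau by
   means of P, and come back to O-linear maps by coinduction *)
have key mu : (forall t, t \in L -> mu * t \in preserves_lattice L) ->
  exists y : 'rV[C]_d, (forall j, y 0 j \in preserves_lattice L) /\
    forall r, saturated r -> dot r y = mu * dot r x.
  move=> muL; pose h r := tau_coord (mu * dot (P r) x).
  have hy r : tau_coord (dot r (coinduced_vec h)) = h r.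
    apply/eqP; rewrite -subr_eq0; apply/eqP.
    apply: (@coinduced_vecP (fun t => t = 0)) => // [t u -> ->|s t]; first by rewrite subrr.
    by rewrite /h raddfD dotDl mulrDr raddfD /=; ring.
  exists (coinduced_vec h); split=> [j|r rsat].
    apply: tau_coord_int => o; rewrite -dot_delta -dotZl hy; apply: tau_coord_lattice_int => //.
    exact: xL.
  apply/eqP; rewrite -subr_eq0; apply/eqP/tau_coord_faithful => o.
  rewrite mulrBr raddfB /= -dotZl hy mulrCA -dotZl /h Psat ?subrr //.
  exact: saturatedZ.
have [y1 [y1O y1P]] := key _ mu1L; have [y2 [y2O y2P]] := key _ mu2L.
exists (y1 + w *: y2); split=> [j|r rsat].
  rewrite !mxE rpredD //; first by have [] := order_in_lattice (y1O j).
  by have [] := order_in_lattice (y2O j).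
rewrite dotBr dotDr dotZr y1P // y2P //.
have -> : mu1 * dot r x + w * (mu2 * dot r x) = (mu1 + mu2 * w) * dot r x by ring.
by rewrite mu12 mul1r subrr.
Qed.

(** A map f which is O-linear from T to C / L is given by a vector. The argument
    is that of saturated_lift, with equalities in O replaced by congruences
    modulo O. *)
Lemma saturated_extend (f : 'rV[O]_d -> C) :
  (forall r s, saturated r -> saturated s -> f (r + s) - f r - f s \in L) ->
  (forall (o : O) r, saturated r -> f (o *: r) - val o * f r \in L) ->
  exists x, forall r, saturated r -> dot r x - f r \in L.
Proof.
move=> fD fZ; have [P [m [m0 mP Psat]]] := saturation_projection.
have satP r : saturated (P r) by exists m%:R; [exact: endE_nat_neq0 | exact: mP].
have [mu1 [mu2 [mu12 mu1L mu2L]]] := lattice_invertible.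
have key mu : (forall t, t \in L -> mu * t \in preserves_lattice L) ->
  exists y : 'rV[C]_d,
    forall r, saturated r -> dot r y - mu * f r \in preserves_lattice L.
  move=> muL; pose h r := tau_coord (mu * f (P r)).
  have hy r : tau_coord (dot r (coinduced_vec h)) - h r \is a Num.int.
    apply: (@coinduced_vecP (fun t => t \is a Num.int)) => // [t u|s t]; first exact: rpredB.
    by rewrite /h raddfD -!raddfB -!mulrBr; apply: tau_coord_lattice_int => //; exact: fD.
  exists (coinduced_vec h) => r rsat; apply: tau_coord_int => o.
  have -> : tau_coord (val o * (dot r (coinduced_vec h) - mu * f r)) =
     (tau_coord (dot (o *: r) (coinduced_vec h)) - h (o *: r))
     + tau_coord (mu * (f (o *: r) - val o * f r)).
    rewrite /h Psat; last exact: saturatedZ.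
    by rewrite mulrBr mulrBr mulrCA -dotZl !raddfB /=; ring.
  by rewrite rpredD //; apply: tau_coord_lattice_int => //; exact: fZ.
have [y1 y1P] := key _ mu1L; have [y2 y2P] := key _ mu2L.
exists (y1 + w *: y2) => r rsat.
have -> : dot r (y1 + w *: y2) - f r =
  (dot r y1 - mu1 * f r) + w * (dot r y2 - mu2 * f r) + (mu1 + mu2 * w - 1) * f r.
  by rewrite dotDr dotZr; ring.
rewrite mu12 subrr mul0r addr0 rpredD //.
  by have [] := order_in_lattice (y1P r rsat).
by have [] := order_in_lattice (y2P r rsat).
Qed.

(** * Connected components of an intersection of kernels *)

Local Notation E := (ellcurve L).
Local Notation piE := (\pi_E : C -> E).
Local Notation piEv := (map_mx piE : 'rV[C]_d -> 'rV[E]_d).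
Local Open Scope classical_set_scope.

(** The pairing O^d x E^d -> E, by which points of E^d are linear maps O^d -> E. *)
Definition edot (r : 'rV[O]_d) (z : 'rV[E]_d) : E := \sum_j r 0 j *: z 0 j.

Lemma pi_ellcurve0 : piE 0 = 0.
Proof. exact: (raddf0 (\pi_(Quotient.quot L))). Qed.

Lemma pi_ellcurve_eq0 (x : C) : (piE x = 0) <-> (x \in L).
Proof.
rewrite -pi_ellcurve0; split=> [/pi_ellcurveP|xL]; first by rewrite subr0.
by apply/pi_ellcurveP; rewrite subr0.
Qed.

Lemma edot_pi r (x : 'rV[C]_d) : edot r (piEv x) = piE (dot r x).
Proof.
rewrite /edot /dot; elim/big_rec2: _ => [|j t u _ ->]; first by rewrite pi_ellcurve0.
by rewrite pi_ellcurveD mxE pi_ellcurveM.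
Qed.

Lemma pi_vec_repr (z : 'rV[E]_d) : exists x, z = piEv x.
Proof. by exists (map_mx repr z); apply/rowP => j; rewrite !mxE reprK. Qed.

Definition ker_dot : set 'rV[E]_d := [set z | forall i, i \in A -> edot (v i) z = 0].

Lemma ker_dot_pi x : ker_dot (piEv x) <-> forall r, r \in span -> dot r x \in L.
Proof.
split=> [xA r|xA i iA]; last first.
  rewrite edot_pi; apply/pi_ellcurve_eq0/xA/asboolP.
  exists 1, (fun=> 1), (fun=> v i); split; first by exists i.
  by rewrite big_ord1 scale1r.
case/asboolP=> k [e [s [sA ->]]]; elim/big_rec: _ => [|i t _ tL].
  by rewrite dot0l rpred0.
rewrite dotDl dotZl rpredD //; have [j jA <-] := sA i.
have /asboolP := valP (e i); apply.
by apply/pi_ellcurve_eq0; rewrite -edot_pi; apply: xA.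
Qed.

(** Equality of the restrictions to the torsion of O^d / span of two linear maps
    into E, see restrict_tors_eq. *)
Definition agree (y z : 'rV[E]_d) := forall r, saturated r -> edot r y = edot r z.

(** The lattice (1 / m) L is discrete. *)
Lemma small_lattice (m : nat) : (0 < m)%N -> exists2 e : R, 0 < e &
  forall z : C, m%:R * z \in L -> `|z| < e%:C%C -> z = 0.
Proof.
move=> m0; have mR : 0 < m%:R :> R by rewrite ltr0n.
(* for m z = p + q w, a bound by |Im w| forces q = 0, and then a bound by 1
   forces p = 0 *)
pose e : R := Num.min 1 `|Im w| / m%:R.
have e0 : 0 < e by rewrite divr_gt0 // lt_min ltr01 normr_gt0.
exists e => // z /L_gen[p [q zE]] ze.
have z2 : Re z ^+ 2 + Im z ^+ 2 < e ^+ 2.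
  rewrite -ltcR add_Re2_Im2 rmorphXn /=.
  by rewrite ltr_pXn2r // nnegrE ?normr_ge0 // lecR ltW.
have ReIm (s t : R) : s ^+ 2 + t ^+ 2 < e ^+ 2 -> `|t| < e.
  move=> st; have : `|t| ^+ 2 < e ^+ 2.
    rewrite real_normK ?num_real //.
    by apply: le_lt_trans st; rewrite lerDr sqr_ge0.
  by rewrite ltr_pXn2r // nnegrE ?normr_ge0 // ltW.
have zI : m%:R * Im z = q%:~R * Im w.
  have := congr1 Im zE; rewrite raddfD /=.
  rewrite -(rmorph_nat (real_complex R)) -!(rmorph_int (real_complex R)).
  by case: (z) => zr zi; case: (w) => wr wi /=; rewrite !mul0r !addr0 add0r.
have zRe : m%:R * Re z = p%:~R + q%:~R * Re w.
  have := congr1 Re zE; rewrite raddfD /=.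
  rewrite -(rmorph_nat (real_complex R)) -!(rmorph_int (real_complex R)).
  by case: (z) => zr zi; case: (w) => wr wi /=; rewrite !mul0r !subr0.
have small (k : int) (t : R) : 0 < t -> `|k%:~R| * t < t -> k = 0.
  move=> t0; rewrite gtr_pMl // -intr_norm -[X in _ < X]/(1%:~R) ltr_int.
  by case: k => [[|k]|k].
have q0 : q = 0.
  apply: (small q `|Im w|); rewrite ?normr_gt0 //.
  rewrite -normrM -zI normrM ger0_norm ?ltW // mulrC -ltr_pdivlMr //.
  by apply: lt_le_trans (ReIm _ _ z2) _; rewrite ler_pM2r ?invr_gt0 // ge_min lexx orbT.
have p0 : p = 0.
  apply: (small p 1) => //; rewrite mulr1.
  have -> : p%:~R = m%:R * Re z by rewrite zRe q0 mul0r addr0.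
  rewrite normrM ger0_norm ?ltW // mulrC -ltr_pdivlMr //.
  move: z2; rewrite addrC => /ReIm z2.
  by apply: lt_le_trans z2 _; rewrite ler_pM2r ?invr_gt0 // ge_min lexx.
move: zE; rewrite p0 q0 mul0r addr0 => /eqP; rewrite mulf_eq0 pnatr_eq0.
by rewrite eqn0Ngt m0 => /eqP.
Qed.

Lemma dot_small r : exists2 M : R, 0 < M &
  forall (e : R) x, 0 < e -> (forall j, `|x 0 j| < e%:C%C) -> `|dot r x| < (M * e)%:C%C.
Proof.
pose M := 1 + \sum_j Re `|val (r 0 j)|.
have norm_re (z : C) : (Re `|z|)%:C%C = `|z|.
  by rewrite RRe_real // ger0_real.
have M0 : 0 <= \sum_j Re `|val (r 0 j)|.
  by apply: sumr_ge0 => j _; rewrite -ler0c norm_re.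
exists M => [|e x e0 xe]; first by rewrite ltr_wpDr.
apply: (@le_lt_trans _ _ ((\sum_j Re `|val (r 0 j)|) * e)%:C%C); last first.
  by rewrite ltcR ltr_pM2r // ltrDr.
rewrite rmorphM rmorph_sum /= mulr_suml; apply: le_trans (ler_norm_sum _ _ _) _.
apply: ler_sum => j _; rewrite normrM norm_re ler_wpM2l //; exact: ltW.
Qed.

(** The projection C -> C / L is open. *)
Lemma pi_ball_nbhs (x : C) (e : R) : 0 < e ->
  nbhs (piE x) [set p | exists2 y : C, p = piE y & `|x - y| < e%:C%C].
Proof.
move=> e0; pose U : set E := [set p | exists2 y : C, p = piE y & `|x - y| < e%:C%C].
have Ux : U (piE x) by exists x; rewrite // subrr normr0 ltcR.
suff Uo : open U by exact: open_nbhs_nbhs.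
suff : open ((piE : R[i]^o -> E) @^-1` U) by [].
rewrite openE => t [y ty xy]; apply/nbhs_ballP.
exists (e%:C%C - `|x - y|); first by rewrite /= subr_gt0.
move=> s; rewrite -ball_normE /= => st.
exists (y + (s - t)).
  apply/pi_ellcurveP; have /pi_ellcurveP : piE t = piE y by [].
  by congr (_ \in L); ring.
apply: le_lt_trans (_ : `|x - y| + `|t - s| < _); last by rewrite addrC -ltrBrDr.
by apply: le_trans (ler_normD _ _); rewrite opprD addrA opprB.
Qed.

(** If two lifts of points of K differ by a small vector e and r is in T, then
    m (r.e) is in L and r.e is small, so r.e = 0. A single bound on e is enough because T is generated by
    the images by P of the generators of O^d. *)
Lemma agree_near z : ker_dot z -> nbhs z [set y | ker_dot y -> agree y z].
Proof.
have [x ->{z}] := pi_vec_repr z => xA.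
have [P [m [m0 mP Psat]]] := saturation_projection.
have [e e0 small] := small_lattice m0.
have /choice[M1 M1P] : forall j : 'I_d, exists M : R, 0 < M /\
  forall (e : R) (x : 'rV[C]_d), 0 < e -> (forall j, `|x 0 j| < e%:C%C) ->
    `|dot (P (delta_mx 0 j)) x| < (M * e)%:C%C.
  by move=> j; have [M M0 MP] := dot_small (P (delta_mx 0 j)); exists M.
have /choice[M2 M2P] : forall j : 'I_d, exists M : R, 0 < M /\
  forall (e : R) (x : 'rV[C]_d), 0 < e -> (forall j, `|x 0 j| < e%:C%C) ->
    `|dot (P (tauO *: delta_mx 0 j)) x| < (M * e)%:C%C.
  by move=> j; have [M M0 MP] := dot_small (P (tauO *: delta_mx 0 j)); exists M.
pose M := 1 + \sum_j (M1 j + M2 j).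
have pos1 j : 0 <= M1 j by rewrite ltW //; case: (M1P j).
have pos2 j : 0 <= M2 j by rewrite ltW //; case: (M2P j).
have leM j : M1 j + M2 j <= M.
  rewrite /M (bigD1 j) //= addrCA lerDl addr_ge0 // sumr_ge0 // => k _.
  exact: addr_ge0.
have M1M j : M1 j <= M by apply: le_trans (leM j); rewrite lerDl.
have M2M j : M2 j <= M by apply: le_trans (leM j); rewrite lerDr.
have M0 : 0 < M by rewrite ltr_wpDr // sumr_ge0 // => k _; exact: addr_ge0.
pose dl := e / M; have dl0 : 0 < dl by rewrite divr_gt0.
have Mdl (N : R) : N <= M -> N * dl <= e.
  by move=> NM; rewrite /dl mulrCA -[X in _ <= X]mulr1 ler_pM2l // ler_pdivrMr // mul1r.
exists (fun _ j => [set p | exists2 y : C, p = piE y & `|x 0 j - y| < dl%:C%C]).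
  by move=> i j; rewrite mxE ord1; exact: pi_ball_nbhs.
move=> y yP.
have /choice[y' y'P] : forall j, exists t : C, y 0 j = piE t /\ `|x 0 j - t| < dl%:C%C.
  by move=> j; have [t] := yP 0 j; exists t.
have -> : y = piEv (\row_j y' j) by apply/rowP => j; rewrite !mxE; case: (y'P j).
set u := \row_j y' j => uA.
have xu (j : 'I_d) : `|(x - u) 0 j| < dl%:C%C by rewrite !mxE; case: (y'P j).
(* both x and u pair with m (P r), which is in the span, to elements of L *)
have small0 r : `|dot (P r) (x - u)| < e%:C%C -> dot (P r) (x - u) = 0.
  apply: small; rewrite -[m%:R](rmorph_nat (val : O -> C)) -dotZl dotBr rpredB //.
    by have /ker_dot_pi := xA; apply.
  by have /ker_dot_pi := uA; apply.
have Pxu r : dot (P r) (x - u) = 0.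
  elim/endE_row_ind: r => [|r s IHr IHs|j|j].
  - by rewrite raddf0 dot0l.
  - by rewrite raddfB dotBl IHr IHs subrr.
  - apply: small0; have [_ MP] := M1P j.
    by apply: lt_le_trans (MP _ _ dl0 xu) _; rewrite lecR Mdl.
  - apply: small0; have [_ MP] := M2P j.
    by apply: lt_le_trans (MP _ _ dl0 xu) _; rewrite lecR Mdl.
move=> r rsat; rewrite !edot_pi; congr piE; apply/eqP.
by rewrite eq_sym -subr_eq0 -dotBr -[r]Psat // Pxu.
Qed.

(** Agreeing with z is both open and closed in K, by agree_near applied to the
    points that agree with z and to those that do not. *)
Lemma connected_agree (X : set 'rV[E]_d) (y z : 'rV[E]_d) :
  connected X -> X `<=` ker_dot -> X z -> X y -> agree y z.
Proof.
move=> Xconn XA Xz Xy.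
have agree_trans (s t u : 'rV[E]_d) : agree s t -> agree t u -> agree s u.
  by move=> st tu r rsat; rewrite st // tu.
have agree_sym (s t : 'rV[E]_d) : agree s t -> agree t s by move=> st r rsat; rewrite st.
pose B := X `&` [set y | agree y z].
suff BX : B = X by have [] : B y by rewrite BX.
apply: Xconn; first by exists z; split.
  exists [set y | ker_dot y -> agree y z]°; first exact: open_interior.
  rewrite eqEsubset; split=> t [Xt tz]; split=> //.
    apply: filterS (agree_near (XA _ Xt)) => s st As.
    exact: agree_trans (st As) tz.
  by have /nbhs_singleton := tz; apply; exact: XA.
exists (~` [set y | ker_dot y -> ~ agree y z]°); first by apply/open_closedC/open_interior.
rewrite eqEsubset; split=> t [Xt tz]; split=> //.
  by move=> /nbhs_singleton/(_ (XA _ Xt)); apply.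
apply: contrapT => ntz; apply: tz.
apply: filterS (agree_near (XA _ Xt)) => s st As sz.
by apply: ntz; apply: agree_trans sz; apply/agree_sym/st.
Qed.

Lemma line_continuous (x y : 'rV[C]_d) :
  continuous (fun t : R => piEv (x + t%:C%C *: y)).
Proof.
move=> t U [P Pnbhs PU].
have near_j j : nbhs t [set s : R | P 0 j (piE (x 0 j + s%:C%C * y 0 j))].
  have : nbhs (piE (x 0 j + t%:C%C * y 0 j)) (P 0 j).
    by have := Pnbhs 0 j; rewrite !mxE.
  move/(@pi_continuous R[i]^o (Quotient.quot L)); move: (P 0 j) => Q /nbhs_ballP[e /= e0 eQ].
  have [e' e'E] : exists e' : R, e = e'%:C%C.
    by exists (Re e); rewrite RRe_real // gtr0_real.
  have {}e0 : 0 < e' by rewrite -ltcR -e'E.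
  pose N := Re `|y 0 j| + 1.
  have N0 : 0 < N by rewrite ltr_wpDl // -ler0c RRe_real // ger0_real.
  have yN : `|y 0 j| <= N%:C%C.
    by rewrite -[leLHS]RRe_real ?ger0_real // lecR /N lerDl ler01.
  apply/nbhs_ballP; exists (e' / N); first by rewrite /= divr_gt0.
  move=> s; rewrite -ball_normE /= => ts; apply: eQ; rewrite -ball_normE /=.
  have -> : x 0 j + t%:C%C * y 0 j - (x 0 j + s%:C%C * y 0 j) = (t - s)%:C%C * y 0 j.
    by rewrite rmorphB /=; ring.
  rewrite normrM e'E normc_def /= expr0n addr0 sqrtr_sqr.
  apply: le_lt_trans (_ : (`|t - s| * N)%:C%C < _).
    by rewrite rmorphM ler_wpM2l // ler0c.
  by rewrite ltcR -ltr_pdivlMr.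
have := filter_forall (nbhs_filter t) near_j; apply: filterS => s sP; apply: PU => i j.
by rewrite !mxE ord1; exact: sP.
Qed.

(** If y and z agree, the difference of their lifts pairs with T to elements of L;
    by saturated_lift it can be corrected by an element of L^d so as to be
    orthogonal to T, and then the line joining the lifts stays in K. *)
Lemma component_of_agree (y z : 'rV[E]_d) : ker_dot y -> ker_dot z -> agree y z ->
  connected_component ker_dot z y.
Proof.
have [x ->{y}] := pi_vec_repr y; have [u ->{z}] := pi_vec_repr z => xA uA xu.
have [l [lL lP]] : exists l : 'rV[C]_d,
    (forall j, l 0 j \in L) /\ (forall r, saturated r -> dot r (x - u - l) = 0).
  apply: saturated_lift => r rsat; have := xu r rsat; rewrite !edot_pi.
  by move/pi_ellcurveP; rewrite dotBr.
set e := x - u - l in lP.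
have -> : piEv x = piEv (u + 1%:C%C *: e).
  apply/rowP => j; rewrite !mxE; apply/pi_ellcurveP.
  by rewrite mul1r; have := lL j; congr (_ \in L); ring.
pose X := (fun t : R => piEv (u + t%:C%C *: e)) @` setT.
apply: (@connected_component_max _ _ X); last by exists 1.
- by exists 0; rewrite // scale0r addr0.
- move=> _ [t _ <-]; apply/ker_dot_pi => r rS.
  rewrite dotDr dotZr lP; last exact: saturated_span.
  by rewrite mulr0 addr0; have /ker_dot_pi := uA; apply.
apply: connected_continuous_connected; first by apply/connected_intervalP => ? ? ? ? ? ?.
exact/continuous_subspaceT/line_continuous.
Qed.

Lemma component_eqP (y z : 'rV[E]_d) : ker_dot y -> ker_dot z ->
  connected_component ker_dot y = connected_component ker_dot z <-> agree y z.
Proof.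
move=> yA zA; split=> [yz|yz]; last first.
  by apply/esym/same_connected_component/component_of_agree.
apply: (@connected_agree (connected_component ker_dot z)) => //.
- exact: component_connected.
- exact: connected_component_sub.
- exact: connected_component_refl.
- by rewrite -yz; exact: connected_component_refl.
Qed.

(** * Linear maps from the torsion to Frac(O) / O *)

Section Duality.
Variables (m : nat) (lambda mu : C) (q : int).
Hypothesis m_gt0 : (0 < m)%N.
Hypothesis m_span : forall r, saturated r -> m%:R *: r \in span.
Hypothesis lambdaL : lambda \in L.
Hypothesis muL : forall z, z \in L -> mu * z \in preserves_lattice L.
Hypothesis mu_lambda : mu * lambda = q%:~R.
Hypothesis q_coprime : coprime (absz q) m.

Local Notation tofrac := (@FracField.tofrac O).
Local Notation piF := (\pi_(frac_quot O) : fracmod O -> frac_quot O).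
Local Notation mO := (m%:R : O).

(** Thus q is invertible modulo m, with inverse q'. *)
Lemma bezout_mq : exists q' k : int, q' * q = 1 + k * m%:Z.
Proof.
have [q' [k qk]] := Bezoutz q m.
exists q', (- k); rewrite mulNr; apply/eqP; rewrite -subr_eq opprK qk.
by rewrite /gcdz /= (eqP q_coprime).
Qed.

Lemma latticeM (o : C) z : o \in preserves_lattice L -> z \in L -> o * z \in L.
Proof. by move/asboolP; apply. Qed.

Lemma latticeMz (k : int) z : z \in L -> k%:~R * z \in L.
Proof. by move=> zL; rewrite mulrzl rpredMz. Qed.

(** Multiplication by mu is injective on the m-torsion of C / L, since
    multiplication by q = lambda mu is. *)
Lemma torsion_lattice z : m%:R * z \in L -> mu * z \in preserves_lattice L -> z \in L.
Proof.
move=> mz muz; have [q' [k qk]] := bezout_mq.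
have -> : z = q'%:~R * (mu * z * lambda) - k%:~R * (m%:R * z).
  have -> : mu * z * lambda = q%:~R * z by rewrite -mu_lambda; ring.
  by rewrite [in RHS]mulrA -rmorphM qk rmorphD rmorphM rmorph1 /= -[m%:~R]pmulrn; ring.
by rewrite rpredB ?latticeMz // latticeM.
Qed.

Lemma fracmodZ (o : O) (x : fracmod O) : o *: x = tofrac o * x :> {fraction O}.
Proof. by []. Qed.

Lemma frac_intP (u : fracmod O) : u \in frac_int O <-> exists o, u = tofrac o.
Proof.
split=> [/asboolP[k [e [s [s1 ->]]]]|[o ->]].
  exists (\sum_i e i); rewrite rmorph_sum; apply: eq_bigr => i _.
  by rewrite s1 fracmodZ rmorph1 mulr1.
apply/asboolP; exists 1, (fun=> o), (fun=> 1); split; first by move=> i; rewrite /= rmorph1.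
by rewrite big_ord1 fracmodZ mulr1.
Qed.

(** The element m mu z of O, for m z in L. *)
Definition mu_scaled (z : C) : O := insubd 0 (mu * (m%:R * z)).

Lemma val_mu_scaled z : m%:R * z \in L -> val (mu_scaled z) = mu * (m%:R * z).
Proof. by move=> mz; rewrite insubdK //; exact: muL. Qed.

(** Multiplication by mu from (1 / m) L to Frac(O) / O. The quotient by m is
    taken in the fraction field because elements of C have no direct meaning
    there. On (1 / m) L it is linear, its kernel is L (tors_frac_eq) and its
    image is the m-torsion (tors_frac_surj). *)
Definition tors_frac (z : C) : frac_quot O := piF (tofrac (mu_scaled z) / tofrac mO).

Let mO_neq0 : tofrac mO != 0.
Proof. by rewrite tofrac_eq0 endE_nat_neq0. Qed.

Let val_mO : val mO = m%:R.
Proof. exact: (rmorph_nat (val : O -> C)). Qed.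

Lemma tors_frac_eq z t : m%:R * z \in L -> m%:R * t \in L ->
  tors_frac z = tors_frac t <-> z - t \in L.
Proof.
move=> mz mt; have mC : m%:R != 0 :> C by rewrite pnatr_eq0 -lt0n.
split=> [/pi_quotmodP/frac_intP[o oE]|ztL].
  apply: torsion_lattice; first by rewrite mulrBr rpredB.
  have : mu_scaled z - mu_scaled t = o * mO.
    by apply/eqP; rewrite -tofrac_eq rmorphB rmorphM /= -oE mulrBl !mulfVK ?eqxx.
  move/(congr1 val); rewrite val_endEB val_endEM !val_mu_scaled // val_mO.
  have -> : mu * (m%:R * z) - mu * (m%:R * t) = mu * (z - t) * m%:R by ring.
  by move/(mulIf mC) => ->; exact: valP.
apply/pi_quotmodP/frac_intP; exists (insubd 0 (mu * (z - t))).
apply: (mulIf mO_neq0); rewrite mulrBl !mulfVK // -rmorphM -rmorphB; congr tofrac.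
apply: val_inj; rewrite val_endEB val_endEM !val_mu_scaled // val_mO insubdK ?muL //.
by ring.
Qed.

Lemma tors_fracD z t : m%:R * z \in L -> m%:R * t \in L -> tors_frac (z + t) = tors_frac z + tors_frac t.
Proof.
move=> mz mt; rewrite /tors_frac -pi_quotmodD; congr piF.
rewrite -mulrDl -rmorphD; congr (tofrac _ / _); apply: val_inj.
by rewrite val_endED !val_mu_scaled ?mulrDr ?rpredD // -!mulrDr.
Qed.

Lemma tors_fracZ (o : O) z : m%:R * z \in L -> tors_frac (val o * z) = o *: tors_frac z.
Proof.
move=> mz; rewrite /tors_frac -[RHS]pi_quotmodZ; congr piF.
rewrite fracmodZ mulrA -rmorphM; congr (tofrac _ / _).
apply: val_inj; rewrite val_endEM !val_mu_scaled //; first by ring.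
by rewrite mulrCA latticeM // (valP o).
Qed.

Lemma tors_frac_lattice z : z \in L -> tors_frac z = 0.
Proof.
move=> zL; have <- : tors_frac 0 = 0.
  rewrite -[X in tors_frac X](mul0r 0) -[X in X * 0]/(val (0 : O)).
  by rewrite tors_fracZ ?scale0r // mulr0 rpred0.
by apply/tors_frac_eq; rewrite ?mulr0 ?rpred0 ?subr0 // -[m%:R]/(m%:Z%:~R) latticeMz.
Qed.

Lemma tors_frac_surj (u : frac_quot O) : mO *: u = 0 ->
  exists2 z, m%:R * z \in L & tors_frac z = u.
Proof.
rewrite -[u]reprK; move: (repr u) => U.
have <- : piF (mO *: U) = mO *: piF U by exact: pi_quotmodZ.
have -> : 0 = piF 0 by rewrite pi_quotmod0.
move/pi_quotmodP; rewrite subr0 => /frac_intP[p pE].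
have [q' [k qk]] := bezout_mq.
have mC : m%:R != 0 :> C by rewrite pnatr_eq0 -lt0n.
have mz : m%:R * (lambda * q'%:~R * val p / m%:R) = q'%:~R * (val p * lambda).
  by field.
have mzL : m%:R * (lambda * q'%:~R * val p / m%:R) \in L.
  by rewrite mz latticeMz // latticeM // (valP p).
exists (lambda * q'%:~R * val p / m%:R) => //.
apply/pi_quotmodP/frac_intP; exists (k%:~R * p).
apply: (mulIf mO_neq0); rewrite mulrBl mulfVK // -rmorphM.
have -> : (U : {fraction O}) * tofrac mO = tofrac p.
  by rewrite -pE fracmodZ mulrC.
rewrite -rmorphB; congr tofrac; apply: val_inj.
rewrite val_endEB !val_endEM val_endE_int val_mO val_mu_scaled // mz.
(* the preimage of p / m is lambda q' p / m, as mu lambda q' = 1 modulo m *)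
have -> : mu * (q'%:~R * (val p * lambda)) = (q'%:~R * q%:~R) * val p.
  by rewrite -mu_lambda; ring.
rewrite -rmorphM qk rmorphD rmorphM rmorph1 /= -[m%:~R]pmulrn; ring.
Qed.

Local Notation M := (realized_module v A).
Local Notation clM := (\pi_M : 'rV[O]_d -> M).

Lemma torsion_class r : clM r \in @is_torsion O M <-> saturated r.
Proof.
split=> [/asboolP[o o0 or]|[o o0 or]].
  exists o => //; rewrite -[_ *: _]subr0; apply/pi_quotmodP.
  by rewrite pi_quotmodZ pi_quotmod0.
apply/asboolP; exists o => //; rewrite -[LHS]pi_quotmodZ -pi_quotmod0.
by apply/pi_quotmodP; rewrite subr0.
Qed.

Lemma torsion_of_saturated : exists g : 'rV[O]_d -> torsion M,
  forall r, saturated r -> val (g r) = clM r.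
Proof.
by exists (fun r => insubd 0 (clM r)) => r rsat; rewrite insubdK //; apply/torsion_class.
Qed.

Lemma tors_class_repr (t : torsion M) : saturated (repr (val t)).
Proof. by apply/torsion_class; rewrite reprK; exact: valP. Qed.

(** The linear map r |-> r.z on the torsion, transported to Frac(O) / O by
    tors_frac. *)
Definition restrict_tors (z : 'rV[E]_d) (t : torsion M) : frac_quot O :=
  tors_frac (repr (edot (repr (val t)) z)).

Lemma dot_torsion (x : 'rV[C]_d) r : ker_dot (piEv x) -> saturated r -> m%:R * dot r x \in L.
Proof. by move=> /ker_dot_pi xA rsat; rewrite -val_mO -dotZl; apply/xA/m_span. Qed.

Lemma restrict_torsE x r t : ker_dot (piEv x) -> saturated r -> val t = clM r ->
  restrict_tors (piEv x) t = tors_frac (dot r x).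
Proof.
move=> xA rsat tr; rewrite /restrict_tors edot_pi.
have s0 : repr (val t) - r \in span by apply/pi_quotmodP; rewrite reprK.
have piL (z : C) : repr (piE z) - z \in L by apply/pi_ellcurveP; rewrite reprK.
have sat_t := tors_class_repr t.
have mL := dot_torsion xA sat_t.
apply/tors_frac_eq; last 1 first.
- rewrite -(subrK (dot (repr (val t)) x) (repr _)) -addrA rpredD // -dotBl.
  by have /ker_dot_pi := xA; apply.
- rewrite -(subrK (dot (repr (val t)) x) (repr _)) mulrDr rpredD //.
  by rewrite -[m%:R]/(m%:Z%:~R) latticeMz.
exact: dot_torsion.
Qed.

Lemma restrict_tors_eq (y z : 'rV[E]_d) : ker_dot y -> ker_dot z -> restrict_tors y = restrict_tors z <-> agree y z.
Proof.
have [x ->{y}] := pi_vec_repr y; have [u ->{z}] := pi_vec_repr z => xA uA.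
have [tors_class val_tors_class] := torsion_of_saturated.
split=> [xu r rsat|xu].
  have := congr1 (fun f => f (tors_class r)) xu.
  rewrite (restrict_torsE xA rsat (val_tors_class r rsat)) (restrict_torsE uA rsat (val_tors_class r rsat)).
  move/tors_frac_eq => /(_ (dot_torsion xA rsat) (dot_torsion uA rsat)) xuL.
  by rewrite !edot_pi; apply/pi_ellcurveP.
by apply/funext => t; rewrite /restrict_tors xu //; exact: tors_class_repr.
Qed.

Lemma restrict_tors_linear (z : 'rV[E]_d) : ker_dot z -> linear (restrict_tors z).
Proof.
have [x ->{z}] := pi_vec_repr z => xA o s t.
have [ss st] := (tors_class_repr s, tors_class_repr t).
rewrite (@restrict_torsE x (o *: repr (val s) + repr (val t))) //; last 2 first.
- exact/saturatedD/st/saturatedZ.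
- rewrite pi_quotmodD pi_quotmodZ !reprK; exact: linearP.
rewrite (@restrict_torsE x (repr (val s))) ?reprK // (@restrict_torsE x (repr (val t))) ?reprK //.
rewrite dotDl dotZl tors_fracD ?tors_fracZ //; try exact: dot_torsion.
by rewrite -dotZl; apply: dot_torsion => //; exact: saturatedZ.
Qed.

(** Through tors_frac, f becomes a linear map from the torsion to the m-torsion of
    E; a set-theoretic lift g of it to C extends to O^d by saturated_extend. *)
Lemma restrict_tors_surj (f : torsion M -> frac_quot O) : linear f ->
  exists2 z, ker_dot z & restrict_tors z = f.
Proof.
move=> flin; have [tors_class val_tors_class] := torsion_of_saturated.
have f0 : f 0 = 0.
  by have := flin (-1) 0 0; rewrite scaler0 addr0 scaleN1r addNr.
have fD (s t : torsion M) : f (s + t) = f s + f t by have := flin 1 s t; rewrite !scale1r.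
have fZ o (s : torsion M) : f (o *: s) = o *: f s by have := flin o s 0; rewrite f0 !addr0.
have tD r s : saturated r -> saturated s -> tors_class (r + s) = tors_class r + tors_class s.
  move=> rsat ssat; apply: val_inj.
  transitivity (val (tors_class r) + val (tors_class s)); last by [].
  rewrite !val_tors_class //; last exact: saturatedD.
  exact: pi_quotmodD.
have tZ o r : saturated r -> tors_class (o *: r) = o *: tors_class r.
  move=> rsat; apply: val_inj.
  transitivity (o *: val (tors_class r)); last by [].
  rewrite !val_tors_class //; last exact: saturatedZ.
  exact: pi_quotmodZ.
have t0 r : r \in span -> tors_class r = 0.
  move=> rS; apply: val_inj; rewrite val_tors_class; last exact: saturated_span.
  by rewrite raddf0 -pi_quotmod0; apply/pi_quotmodP; rewrite subr0.
have /choice[g gP] : forall r, exists z : C,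
    saturated r -> m%:R * z \in L /\ tors_frac z = f (tors_class r).
  move=> r; have [rsat|] := pselect (saturated r); last by exists 0.
  have [|z mz zE] := @tors_frac_surj (f (tors_class r)); last by exists z.
  by rewrite -fZ -tZ // t0 // m_span.
have [||x xP] := @saturated_extend g.
- move=> r s rsat ssat; have [mr rE] := gP r rsat; have [ms sE] := gP s ssat.
  have [mrs rsE] := gP _ (saturatedD rsat ssat).
  rewrite -addrA -opprD; apply/tors_frac_eq; rewrite ?mulrDr ?rpredD //.
  by rewrite rsE tD // fD -rE -sE tors_fracD.
- move=> o r rsat; have [mr rE] := gP r rsat.
  have [mor orE] := gP _ (saturatedZ o rsat).
  apply/tors_frac_eq; rewrite ?orE ?tZ ?fZ -?rE ?tors_fracZ //.
  by rewrite mulrCA latticeM // (valP o).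
have xA : ker_dot (piEv x).
  apply/ker_dot_pi => r rS; have rsat := saturated_span rS.
  have [mr rE] := gP r rsat; rewrite -(subrK (g r) (dot r x)) rpredD ?xP //.
  rewrite -[g r]subr0; apply/tors_frac_eq; rewrite ?mulr0 ?rpred0 //.
  by rewrite rE t0 // f0 tors_frac_lattice ?rpred0.
exists (piEv x) => //; apply/funext => t.
have tsat := tors_class_repr t.
rewrite (@restrict_torsE x (repr (val t))) ?reprK //.
have [mr rE] := gP _ tsat.
have -> : tors_frac (dot (repr (val t)) x) = tors_frac (g (repr (val t))).
  by apply/tors_frac_eq => //; [exact: dot_torsion | exact: xP].
by rewrite rE; congr f; apply: val_inj; rewrite val_tors_class ?reprK.
Qed.

End Duality.

(** * Multiplicities and ranks *)

Lemma card_components :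
  card_set [set connected_component ker_dot z | z in ker_dot] = card_dual (torsion (realized_module v A)).
Proof.
have [P [m [m0 mP Psat]]] := saturation_projection.
have m_span r : saturated r -> m%:R *: r \in span by move=> rsat; rewrite -(Psat r).
have [lambda [mu [q [lamL muL mulam qm]]]] := lattice_coprime_pair m0.
have ker_dot0 : ker_dot 0.
  by move=> i _; rewrite /edot big1 // => j _; rewrite mxE scaler0.
rewrite (@card_set_image_eq _ _ _ ker_dot 0 (connected_component ker_dot) (restrict_tors m mu)).
  congr card_set; rewrite eqEsubset; split=> [_ [z zA <-]|f flin].
    by rewrite /mkset; have := restrict_tors_linear m0 m_span lamL muL mulam qm zA.
  by have [z zA <-] := restrict_tors_surj m0 m_span lamL muL mulam qm flin; exists z.
move=> y z yA zA; rewrite component_eqP //.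
exact: iff_sym (restrict_tors_eq m0 m_span lamL muL mulam qm yA zA).
Qed.

(** If t (v_i.x) is in L for all real t, a small t > 0 gives t (v_i.x) = 0. *)
Lemma lie_algebra_ker_dot : lie_algebra ker_dot = [set x | forall i, i \in A -> dot (v i) x = 0].
Proof.
rewrite eqEsubset; split=> x xA; last first.
  move=> t i iA; rewrite edot_pi dotZr xA // mulr0; exact: pi_ellcurve0.
move=> i iA; have [e e0 small] := small_lattice (isT : (0 < 1)%N).
set z := dot (v i) x.
pose N := Re `|z| + 1.
have N0 : 0 < N by rewrite ltr_wpDl // -ler0c RRe_real // ger0_real.
pose t := e / N; have t0 : 0 < t by rewrite divr_gt0.
have /eqP : t%:C%C * z = 0.
  apply: small.
    by rewrite mul1r /z -dotZr; apply/pi_ellcurve_eq0; rewrite -edot_pi; exact: (xA t).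
  rewrite normrM -[Num.norm z]RRe_real ?ger0_real // [X in X * _]ger0_norm ?ler0c ?ltW //.
  by rewrite -rmorphM ltcR /t -mulrA gtr_pMr // mulrC ltr_pdivrMr // mul1r ltrDl.
by rewrite mulf_eq0 => /orP[|/eqP//]; rewrite eq_complex /= eqxx andbT gt_eqF.
Qed.

Lemma complex_codim_ker_dot :
  complex_codim ker_dot = \rank (map_mx (@FracField.tofrac O) (relation_mx A v)).
Proof.
rewrite (@rank_tofrac _ _ (val : O -> C) val_inj).
set N := map_mx _ _; rewrite /complex_codim lie_algebra_ker_dot.
have NE (x : 'rV[C]_d) i : (x *m N^T) 0 i = dot (row i (relation_mx A v)) x.
  by rewrite mxE; apply: eq_bigr => j _; rewrite !mxE mulrC.
have kerE (x : 'rV[C]_d) :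
    (forall i, i \in A -> dot (v i) x = 0) <-> (x <= kermx N^T)%MS.
  split=> [xA|/sub_kermxP xN i iA].
    apply/sub_kermxP/rowP => i; rewrite NE mxE rowK.
    by case: ifP => [/xA//|_]; exact: dot0l.
  by have := NE x i; rewrite xN mxE rowK iA.
pose B := row_base (kermx N^T).
have BE (e : 'I_(\rank (kermx N^T)) -> C) : \sum_i e i *: row i B = (\row_i e i) *m B.
  by rewrite mulmx_sum_row; apply: eq_bigr => i _; rewrite mxE.
rewrite (@dim_ofE _ _ _ _ (fun i => row i B)).
- by rewrite mxrank_ker mxrank_tr subKn // rank_leq_col.
- move=> x; apply: iff_trans (kerE x) _; rewrite -(eq_row_base (kermx N^T)).
  split=> [/submxP[y ->]|[e ->]]; last by rewrite BE submxMl.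
  by exists (fun i => y 0 i); rewrite BE; congr (_ *m _); apply/rowP => i; rewrite mxE.
- move=> e; rewrite BE -(mul0mx _ B) => /(row_free_inj (row_base_free _))/rowP e0 i.
  by have := e0 i; rewrite !mxE.
Qed.

Lemma rk_realized : rk_mod (realized_module v) A =
  \rank (map_mx (@FracField.tofrac O) (relation_mx A v)).
Proof.
rewrite /rk_mod !generic_rank_realized.
have -> : relation_mx finset.set0 v = 0.
  by apply/matrixP => i j; rewrite !mxE inE mxE.
by rewrite map_mx0 mxrank0 subn0 subKn // rank_leq_col.
Qed.

End Saturation.
End Lattice.
End CMOrder.

Theorem proposition6p1 (R : realType) (L : zmodClosed R[i]) (w : R[i])
    (d n : nat) (l : 'I_n -> 'rV[ellcurve L]_d -> ellcurve L)
    (v : 'I_n -> 'rV[endE L]_d)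
    (L_lattice : is_lattice L)
    (L_gen : forall z, z \in L <-> exists a b : int, z = a%:~R + b%:~R * w)
    (w_quadratic : quadratic_over_Q w)
    (l_form : forall i z, l i z = \sum_j v i 0 j *: z 0 j)
    (l_neq0 : forall i, exists z, l i z <> 0) :
  elliptic_tutte l = grothendieck_tutte_card (realized_module v).
Proof.
have [a [b [c [w_root abc]]]] := quadratic_equation w_quadratic.
have w_notreal := lattice_not_real L_lattice L_gen.
have ker_interE A : ker_inter l A = ker_dot v A.
  by apply/funext => z; apply/propext; split=> zA i /zA; rewrite l_form.
rewrite /elliptic_tutte /grothendieck_tutte_card; congr tutte_sum; apply/funext => A.
  rewrite /nb_components ker_interE.
  exact: (card_components L_gen w_notreal w_root abc).
rewrite ker_interE rk_realized.
exact: (complex_codim_ker_dot L_gen w_notreal).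
Qed.
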